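(* Let $(\mathcal{C},\mathbb{E},\mathfrak{s})$ be an extriangulated category satisfying weak idempotent completeness (WIC), and let $\xi$ be a proper class of $\mathbb{E}$-triangles such that $\mathcal{C}$ has enough $\xi$-projectives and enough $\xi$-injectives. Assume that $\mathcal{P}(\xi)$ is a generating subcategory of $\mathcal{C}$ and $\mathcal{I}(\xi)$ is a cogenerating subcategory of $\mathcal{C}$. For any non-negative integer $m$ consider the conditions: (1) $\sup\{\xi\text{-}\mathcal{G}\mathrm{pd}\,M\mid M\in\mathcal{C}\}\leq m$; (2) $\sup\{\xi\text{-}\mathcal{G}\mathrm{id}\,M\mid M\in\mathcal{C}\}\leq m$; (3) $\xi\text{-}\mathrm{spli}\,\mathcal{C}=\xi\text{-}\mathrm{silp}\,\mathcal{C}\leq m$. Then (1)$\Rightarrow$(3) and (2)$\Rightarrow$(3). The converses (3)$\Rightarrow$(1) and (3)$\Rightarrow$(2) hold if $\mathcal{C}$ satisfies the following Condition $(\star)$: if $N\in\mathcal{C}$ and $M\in\widetilde{\mathcal{P}}(\xi)$ are such that $\xi\mathrm{xt}^i_\xi(M,N)=0$ for all $i\ge1$, then $\mathcal{C}(M,N)\cong\xi\mathrm{xt}^0_\xi(M,N)$ (via the natural map); dually, if $N\in\mathcal{C}$ and $M\in\widetilde{\mathcal{I}}(\xi)$ are such that $\xi\mathrm{xt}^i_\xi(N,M)=0$ for all $i\ge1$, then $\mathcal{C}(N,M)\cong\xi\mathrm{xt}^0_\xi(N,M)$ (via the natural map).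
   Context: **Extriangulated categories (Nakaoka–Palu).** Let $\mathcal{C}$ be an additive category and $\mathbb{E}:\mathcal{C}^{\mathrm{op}}\times\mathcal{C}\to\mathrm{Ab}$ an additive bifunctor. For $\delta\in\mathbb{E}(C,A)$, $a:A\to A'$, $c:C'\to C$ write $a_*\delta=\mathbb{E}(C,a)(\delta)$, $c^*\delta=\mathbb{E}(c,A)(\delta)$. A morphism from $\delta\in\mathbb{E}(C,A)$ to $\delta'\in\mathbb{E}(C',A')$ is a pair $(a:A\to A',c:C\to C')$ with $a_*\delta=c^*\delta'$. Sequences $A\xrightarrow{x}B\xrightarrow{y}C$ and $A\xrightarrow{x'}B'\xrightarrow{y'}C$ are equivalent if there is an isomorphism $b:B\to B'$ with $bx=x'$, $y'b=y$; $[\,\cdot\,]$ denotes the class. A realization $\mathfrak{s}$ assigns to each $\delta\in\mathbb{E}(C,A)$ a class $\mathfrak{s}(\delta)=[A\xrightarrow{x}B\xrightarrow{y}C]$ such that for every morphism $(a,c):\delta\to\delta'$ with $\mathfrak{s}(\delta')=[A'\xrightarrow{x'}B'\xrightarrow{y'}C']$ there is $b:B\to B'$ with $bx=x'a$, $y'b=cy$. It is additive if $\mathfrak{s}(0)=[A\to A\oplus C\to C]$ and $\mathfrak{s}(\delta\oplus\delta')=\mathfrak{s}(\delta)\oplus\mathfrak{s}(\delta')$. If $\mathfrak{s}(\delta)=[A\xrightarrow{x}B\xrightarrow{y}C]$, one writes $A\xrightarrow{x}B\xrightarrow{y}C\overset{\delta}{\dashrightarrow}$, calls this an $\mathbb{E}$-triangle,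 calls $A\to B\to C$ a conflation, $x$ an inflation, $y$ a deflation. $(\mathcal{C},\mathbb{E},\mathfrak{s})$ is extriangulated if $\mathfrak{s}$ is an additive realization and: (ET3) for $\mathbb{E}$-triangles $A\xrightarrow{x}B\xrightarrow{y}C\overset{\delta}{\dashrightarrow}$, $A'\xrightarrow{x'}B'\xrightarrow{y'}C'\overset{\delta'}{\dashrightarrow}$ and $a,b$ with $bx=x'a$, there is $c$ with $cy=y'b$ and $a_*\delta=c^*\delta'$; (ET3)$^{\mathrm{op}}$ is the dual (given $b,c$ with $cy=y'b$, there is $a$). (ET4) for $\mathbb{E}$-triangles $A\xrightarrow{f}B\xrightarrow{f'}D\overset{\delta}{\dashrightarrow}$ and $B\xrightarrow{g}C\xrightarrow{g'}F\overset{\delta'}{\dashrightarrow}$ there are an object $E$, an $\mathbb{E}$-triangle $A\xrightarrow{h}C\xrightarrow{h'}E\overset{\delta''}{\dashrightarrow}$ with $h=gf$, and morphisms $d:D\to E$, $e:E\to F$ with $h'g=df'$, $eh'=g'$, such that $D\xrightarrow{d}E\xrightarrow{e}F$ realizes $f'_*\delta'$, $d^*\delta''=\delta$, and $f_*\delta''=e^*\delta'$; (ET4)$^{\mathrm{op}}$ is the dual. (WIC): if $gf$ is an inflation then $f$ is an inflation; if $gf$ is a deflation then $g$ is a deflation. **Proper classes.** A class $\xi$ of $\mathbb{E}$-triangles closed under isomorphisms is proper if: (a) it is closed under finite coproducts and contains all split $\mathbb{E}$-triangles (those with $\delta=0$); (b) it is closed under base change ($\delta\mapsto c^*\delta$)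 and cobase change ($\delta\mapsto a_*\delta$); (c) it is saturated: given $\mathbb{E}$-triangles $A_1\xrightarrow{x_1}B_1\xrightarrow{y_1}C\overset{\delta_1}{\dashrightarrow}$ and $A_2\xrightarrow{x_2}B_2\xrightarrow{y_2}C\overset{\delta_2}{\dashrightarrow}$, if the $\mathbb{E}$-triangle of $\delta_2$ and the $\mathbb{E}$-triangle $A_1\to M\to B_2$ realizing $y_2^*\delta_1$ are in $\xi$, then so is the $\mathbb{E}$-triangle of $\delta_1$. **Projectives and injectives.** $P$ is $\xi$-projective if for every $A\to B\to C\dashrightarrow$ in $\xi$ the sequence $0\to\mathcal{C}(P,A)\to\mathcal{C}(P,B)\to\mathcal{C}(P,C)\to0$ is exact; $\xi$-injective is dual. $\mathcal{P}(\xi)$, $\mathcal{I}(\xi)$ are the full subcategories of $\xi$-projectives and $\xi$-injectives. Enough $\xi$-projectives (resp. $\xi$-injectives): every $A$ admits an $\mathbb{E}$-triangle $K\to P\to A\dashrightarrow$ (resp. $A\to I\to K\dashrightarrow$) in $\xi$ with $P\in\mathcal{P}(\xi)$ (resp. $I\in\mathcal{I}(\xi)$). **Dimensions.** $\xi\text{-}\mathrm{pd}\,A=0$ iff $A\in\mathcal{P}(\xi)$; inductively $\xi\text{-}\mathrm{pd}\,A\le n$ if there is $K\to P\to A\dashrightarrow$ in $\xi$ with $P\in\mathcal{P}(\xi)$ and $\xi\text{-}\mathrm{pd}\,K\le n-1$; the dimension is the least such $n$, or $\infty$. $\xi\text{-}\mathrm{id}$ is dual. $\widetilde{\mathcal{P}}(\xi)$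 (resp. $\widetilde{\mathcal{I}}(\xi)$) is the class of objects of finite $\xi$-projective (resp. $\xi$-injective) dimension. Put $\xi\text{-}\mathrm{silp}\,\mathcal{C}=\sup\{\xi\text{-}\mathrm{id}\,P\mid P\in\mathcal{P}(\xi)\}$ and $\xi\text{-}\mathrm{spli}\,\mathcal{C}=\sup\{\xi\text{-}\mathrm{pd}\,I\mid I\in\mathcal{I}(\xi)\}$. **$\xi$-$\mathcal{G}$projectives and $\xi$-$\mathcal{G}$injectives.** An $\mathbb{E}$-triangle $A\to B\to C\dashrightarrow$ in $\xi$ is $\mathcal{C}(-,\mathcal{W})$-exact if $0\to\mathcal{C}(C,W)\to\mathcal{C}(B,W)\to\mathcal{C}(A,W)\to0$ is exact for all $W\in\mathcal{W}$, and $\mathcal{C}(\mathcal{W},-)$-exact if $0\to\mathcal{C}(W,A)\to\mathcal{C}(W,B)\to\mathcal{C}(W,C)\to0$ is exact for all $W\in\mathcal{W}$. A complete $\xi$-projective resolution is a complex $\cdots\to P_1\to P_0\to P_{-1}\to\cdots$ with all $P_n\in\mathcal{P}(\xi)$ together with, for each $n\in\mathbb{Z}$, a $\mathcal{C}(-,\mathcal{P}(\xi))$-exact $\mathbb{E}$-triangle $K_{n+1}\xrightarrow{g_n}P_n\xrightarrow{f_n}K_n\dashrightarrow$ in $\xi$, with differential $d_n=g_{n-1}f_n$. The objects $K_n$ so arising are the $\xi$-$\mathcal{G}$projective objects, forming $\mathcal{GP}(\xi)$. Dually, a complete $\xi$-injective coresolution has all terms $I_n\in\mathcal{I}(\xi)$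 and $\mathcal{C}(\mathcal{I}(\xi),-)$-exact $\mathbb{E}$-triangles $K_{n+1}\to I_n\to K_n\dashrightarrow$ in $\xi$; the $K_n$ are the $\xi$-$\mathcal{G}$injective objects, forming $\mathcal{GI}(\xi)$. The dimensions $\xi\text{-}\mathcal{G}\mathrm{pd}$ and $\xi\text{-}\mathcal{G}\mathrm{id}$ are defined inductively as $\xi\text{-}\mathrm{pd}$ and $\xi\text{-}\mathrm{id}$ with $\mathcal{GP}(\xi)$, $\mathcal{GI}(\xi)$ in place of $\mathcal{P}(\xi)$, $\mathcal{I}(\xi)$. **Derived functors.** A $\xi$-projective resolution $\mathbf{P}\to A$ consists of $\mathbb{E}$-triangles $K_{n+1}\to P_n\to K_n\dashrightarrow$ in $\xi$ ($n\ge0$) with $K_0=A$, $P_n\in\mathcal{P}(\xi)$, with $\mathbf{P}$ the spliced complex $\cdots\to P_1\to P_0$; $\xi\mathrm{xt}^n_\xi(A,B)=H^n(\mathcal{C}(\mathbf{P},B))$ for $n\ge0$ (independent of the choice, and isomorphic to $H^n(\mathcal{C}(A,\mathbf{I}))$ for a $\xi$-injective coresolution $B\to\mathbf{I}$, defined dually). There is a natural map $\mathcal{C}(A,B)\to\xi\mathrm{xt}^0_\xi(A,B)$ (precomposition with $P_0\to A$). **Generating.** A full subcategory $\mathcal{X}$ of $\mathcal{C}$ is generating if for all $A\in\mathcal{C}$, $\mathcal{C}(X,A)=0$ for all $X\in\mathcal{X}$ implies $A=0$. A full subcategory $\mathcal{Y}$ is cogenerating if for all $B\in\mathcal{C}$,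 $\mathcal{C}(B,Y)=0$ for all $Y\in\mathcal{Y}$ implies $B=0$. *)

(* Defs.v *)
From HB Require Import structures.
From mathcomp Require Import all_boot all_order all_algebra.
From mathcomp Require Import boolp classical_sets.

Set Implicit Arguments.
Unset Strict Implicit.
Unset Printing Implicit Defensive.

Import GRing.Theory.
Local Open Scope ring_scope.
Local Open Scope classical_set_scope.

Definition short_exact (U V W : zmodType) (f : U -> V) (g : V -> W) : Prop :=
  [/\ injective f,
      (forall v, g v = 0 <-> exists u, f u = v)
    & (forall w, exists v, g v = w)].

Section Homology.
Variables (U V W : zmodType) (f : {additive U -> V}) (g : {additive V -> W}).

Definition in_ker : {pred V} := fun v => g v == 0.

Fact in_ker_zmod_closed : zmod_closed in_ker.
Proof.
split=> [|u v]; rewrite !unfold_in /in_ker ?raddf0 // raddfB.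
by move=> /eqP-> /eqP->; rewrite subr0.
Qed.
HB.instance Definition _ := GRing.isZmodClosed.Build V in_ker in_ker_zmod_closed.

Definition cycles : Type := {v : V | v \in in_ker}.
HB.instance Definition _ := Choice.on cycles.
HB.instance Definition _ := SubType.on cycles.
HB.instance Definition _ := [SubChoice_isSubZmodule of cycles by <:].

Definition boundaries : {pred cycles} := fun z => `[< exists u : U, f u = \val z >].

Fact boundaries_zmod_closed : zmod_closed boundaries.
Proof.
split=> [|y z]; rewrite !unfold_in /boundaries.
  by apply/asboolP; exists 0; rewrite raddf0 raddf0.
move=> /asboolP[u fu] /asboolP[v fv]; apply/asboolP; exists (u - v).
by rewrite raddfB fu fv raddfB.
Qed.
HB.instance Definition _ :=
  GRing.isZmodClosed.Build cycles boundaries boundaries_zmod_closed.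

(* The quotient of ker g by im f :&: ker g, so g \o f = 0 is not needed. *)
Definition homology : zmodType := Quotient.quot boundaries.

End Homology.

(* The extended naturals; the supremum of a set is its least upper bound, so
   the supremum of the empty set is Fin 0. *)
Inductive enat := Fin of nat | Infty.

Definition enat_le (d e : enat) : Prop :=
  match d, e with
  | _, Infty => True
  | Infty, Fin _ => False
  | Fin m, Fin n => (m <= n)%N
  end.

Definition least (P : nat -> Prop) : enat :=
  match pselect (exists n, `[< P n >]) with
  | left exP => Fin (ex_minn exP)
  | right _ => Infty
  end.

Definition esup (S : set enat) : enat :=
  least (fun n => forall d, S d -> enat_le d (Fin n)).

Record preadditive := Preadditive {
  ob :> Type;
  hom : ob -> ob -> zmodType;
  idm : forall A, hom A A;
  comp : forall A B C, hom B C -> hom A B -> hom A C;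
  comp1m : forall A B (f : hom A B), comp (idm B) f = f;
  compm1 : forall A B (f : hom A B), comp f (idm A) = f;
  compA : forall A B C D (h : hom C D) (g : hom B C) (f : hom A B),
    comp h (comp g f) = comp (comp h g) f;
  compDl : forall A B C (g g' : hom B C) (f : hom A B),
    comp (g + g') f = comp g f + comp g' f;
  compDr : forall A B C (g : hom B C) (f f' : hom A B),
    comp g (f + f') = comp g f + comp g f'
}.
Arguments idm {p} A.

Notation "g \oc f" := (comp g f) (at level 40, left associativity).

Section Preadditive.
Variable cC : preadditive.
Implicit Types A B C Z : cC.

Definition is_zero_object Z : Prop :=
  (forall A (f : hom A Z), f = 0) /\ (forall A (f : hom Z A), f = 0).

Record biproduct A B := Biproduct {
  bip :> cC;
  inl : hom A bip;
  inr : hom B bip;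
  prl : hom bip A;
  prr : hom bip B;
  prl_inl : prl \oc inl = idm A;
  prr_inr : prr \oc inr = idm B;
  prl_inr : prl \oc inr = 0;
  prr_inl : prr \oc inl = 0;
  bip_id : inl \oc prl + inr \oc prr = idm bip
}.

Definition is_iso A B (f : hom A B) : Prop :=
  exists g : hom B A, g \oc f = idm A /\ f \oc g = idm B.

Definition precomp A A' (f : hom A A') B (u : hom A' B) : hom A B := u \oc f.
Definition postcomp B B' (f : hom B B') A (u : hom A B) : hom A B' := f \oc u.

Fact precomp_additive A A' (f : hom A A') B : zmod_morphism (@precomp A A' f B).
Proof.
move=> u v; rewrite /precomp; apply: (addIr (v \oc f)).
by rewrite -compDl !subrK.
Qed.
HB.instance Definition _ A A' (f : hom A A') B :=
  GRing.isZmodMorphism.Build (hom A' B) (hom A B) (@precomp A A' f B)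
    (@precomp_additive A A' f B).

Definition biproduct_map A A' B B' (S : biproduct A A') (T : biproduct B B')
    (f : hom A B) (f' : hom A' B') : hom S T :=
  inl T \oc f \oc prl S + inr T \oc f' \oc prr S.

End Preadditive.

Record additive_category := AdditiveCategory {
  preadd :> preadditive;
  zero_ex : exists Z : preadd, is_zero_object Z;
  biproduct_ex : forall A B : preadd, inhabited (biproduct A B)
}.

(* Ext C A is E(C, A), contravariant in C; push a d is a_* d, pull c d is c^* d. *)
Record ext_bifunctor (cC : additive_category) := ExtBifunctor {
  Ext :> cC -> cC -> zmodType;
  push : forall C A A', hom A A' -> Ext C A -> Ext C A';
  pull : forall C C' A, hom C' C -> Ext C A -> Ext C' A;
  push1 : forall C A (d : Ext C A), push (idm A) d = d;
  pull1 : forall C A (d : Ext C A), pull (idm C) d = d;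
  pushM : forall C A A' A'' (a' : hom A' A'') (a : hom A A') (d : Ext C A),
    push (a' \oc a) d = push a' (push a d);
  pullM : forall C C' C'' A (c : hom C' C) (c' : hom C'' C') (d : Ext C A),
    pull (c \oc c') d = pull c' (pull c d);
  push_pull : forall C C' A A' (a : hom A A') (c : hom C' C) (d : Ext C A),
    push a (pull c d) = pull c (push a d);
  pushD : forall C A A' (a : hom A A') (d d' : Ext C A),
    push a (d + d') = push a d + push a d';
  pullD : forall C C' A (c : hom C' C) (d d' : Ext C A),
    pull c (d + d') = pull c d + pull c d';
  push_addm : forall C A A' (a a' : hom A A') (d : Ext C A),
    push (a + a') d = push a d + push a' d;
  pull_addm : forall C C' A (c c' : hom C' C) (d : Ext C A),
    pull (c + c') d = pull c d + pull c' d
}.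

Definition tri_pred (cC : additive_category) (E : ext_bifunctor cC) : Type :=
  forall A B C : cC, hom A B -> hom B C -> E C A -> Prop.

Section Realization.
Variables (cC : additive_category) (E : ext_bifunctor cC).
Implicit Types A B C D F : cC.

Definition seq_equiv A C B B' (x : hom A B) (y : hom B C)
    (x' : hom A B') (y' : hom B' C) : Prop :=
  exists b : hom B B', [/\ is_iso b, b \oc x = x' & y' \oc b = y].

Definition ext_sum C C' A A' (SC : biproduct C C') (SA : biproduct A A')
    (d : E C A) (d' : E C' A') : E SC SA :=
  push (inl SA) (pull (prl SC) d) + push (inr SA) (pull (prr SC) d').

(* The class s(d) is encoded by its membership predicate: s A B C x y d means
   that A --x--> B --y--> C belongs to s(d). *)
Variable s : tri_pred E.

Definition assigns_classes : Prop :=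
  forall A C (d : E C A), exists B (x : hom A B) (y : hom B C),
    forall B' (x' : hom A B') (y' : hom B' C),
      s x' y' d <-> seq_equiv x y x' y'.

Definition lifts_morphisms : Prop :=
  forall A B C A' B' C' (x : hom A B) (y : hom B C) (d : E C A)
    (x' : hom A' B') (y' : hom B' C') (d' : E C' A')
    (a : hom A A') (c : hom C C'),
  s x y d -> s x' y' d' -> push a d = pull c d' ->
  exists b : hom B B', b \oc x = x' \oc a /\ y' \oc b = c \oc y.

Definition realization : Prop := assigns_classes /\ lifts_morphisms.

Definition additive_realization : Prop :=
  (forall A C (S : biproduct A C), s (inl S) (prr S) (0 : E C A)) /\
  (forall A B C A' B' C' (x : hom A B) (y : hom B C) (d : E C A)
     (x' : hom A' B') (y' : hom B' C') (d' : E C' A')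
     (SA : biproduct A A') (SB : biproduct B B') (SC : biproduct C C'),
   s x y d -> s x' y' d' ->
   s (biproduct_map SA SB x x') (biproduct_map SB SC y y') (ext_sum SC SA d d')).

Definition ET3 : Prop :=
  forall A B C A' B' C' (x : hom A B) (y : hom B C) (d : E C A)
    (x' : hom A' B') (y' : hom B' C') (d' : E C' A')
    (a : hom A A') (b : hom B B'),
  s x y d -> s x' y' d' -> b \oc x = x' \oc a ->
  exists c : hom C C', c \oc y = y' \oc b /\ push a d = pull c d'.

Definition ET3op : Prop :=
  forall A B C A' B' C' (x : hom A B) (y : hom B C) (d : E C A)
    (x' : hom A' B') (y' : hom B' C') (d' : E C' A')
    (b : hom B B') (c : hom C C'),
  s x y d -> s x' y' d' -> c \oc y = y' \oc b ->
  exists a : hom A A', b \oc x = x' \oc a /\ push a d = pull c d'.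

Definition ET4 : Prop :=
  forall A B C D F (f : hom A B) (f' : hom B D) (del : E D A)
    (g : hom B C) (g' : hom C F) (del' : E F B),
  s f f' del -> s g g' del' ->
  exists (G : cC) (h : hom A C) (h' : hom C G) (del'' : E G A)
         (d : hom D G) (e : hom G F),
    [/\ s h h' del'', h = g \oc f, h' \oc g = d \oc f' & e \oc h' = g'] /\
    [/\ s d e (push f' del'), pull d del'' = del & push f del'' = pull e del'].

Definition ET4op : Prop :=
  forall A B C D F (f' : hom D B) (f : hom B A) (del : E A D)
    (g' : hom F C) (g : hom C B) (del' : E B F),
  s f' f del -> s g' g del' ->
  exists (G : cC) (h' : hom G C) (h : hom C A) (del'' : E A G)
         (d : hom G D) (e : hom F G),
    [/\ s h' h del'', h = f \oc g, g \oc h' = f' \oc d & h' \oc e = g'] /\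
    [/\ s e d (pull f' del'), push d del'' = del & pull f del'' = push e del'].

End Realization.

Record extriangulated := Extriangulated {
  ecat :> additive_category;
  ext : ext_bifunctor ecat;
  etri : tri_pred ext;
  etri_realization : realization etri;
  etri_additive : additive_realization etri;
  etri_ET3 : ET3 etri;
  etri_ET3op : ET3op etri;
  etri_ET4 : ET4 etri;
  etri_ET4op : ET4op etri
}.
Arguments ext : clear implicits.
Arguments etri {e A B C} x y d.

Definition inflation (cC : extriangulated) (A B : cC) (x : hom A B) : Prop :=
  exists (C : cC) (y : hom B C) (d : ext cC C A), etri x y d.

Definition deflation (cC : extriangulated) (B C : cC) (y : hom B C) : Prop :=
  exists (A : cC) (x : hom A B) (d : ext cC C A), etri x y d.

Definition WIC (cC : extriangulated) : Prop :=
  (forall (A B C : cC) (f : hom A B) (g : hom B C),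
     inflation (g \oc f) -> inflation f) /\
  (forall (A B C : cC) (f : hom A B) (g : hom B C),
     deflation (g \oc f) -> deflation g).

Section ProperClass.
Variable cC : extriangulated.
Local Notation E := (ext cC).
Implicit Types A B C P I K M N : cC.

Lemma comp0m A B C (f : hom A B) : (0 : hom B C) \oc f = 0.
Proof. exact: (raddf0 (precomp f (B := C))). Qed.

Lemma etri_comp0 A B C (x : hom A B) (y : hom B C) (d : E C A) :
  etri x y d -> y \oc x = 0.
Proof.
move=> xyd; have [Z [toZ fromZ]] := zero_ex cC.
have [S] := biproduct_ex A Z.
have split_tri := (etri_additive cC).1 A Z S.
have e : x \oc prl S \oc inl S = x \oc idm A by rewrite -compA prl_inl.
have [c [ec _]] := etri_ET3 split_tri xyd e.
rewrite (fromZ _ c) comp0m in ec.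
by rewrite -[LHS]compm1 -(prl_inl S) compA -(compA y) -ec comp0m.
Qed.

Definition etri_iso A B C A' B' C' (x : hom A B) (y : hom B C) (d : E C A)
    (x' : hom A' B') (y' : hom B' C') (d' : E C' A') : Prop :=
  exists (a : hom A A') (b : hom B B') (c : hom C C'),
    [/\ is_iso a, is_iso b & is_iso c] /\
    [/\ b \oc x = x' \oc a, c \oc y = y' \oc b & push a d = pull c d'].

Record etri_class := EtriClass {
  in_xi : tri_pred E;
  xi_etri : forall A B C (x : hom A B) (y : hom B C) (d : E C A),
    in_xi x y d -> etri x y d;
  xi_iso : forall A B C A' B' C' (x : hom A B) (y : hom B C) (d : E C A)
      (x' : hom A' B') (y' : hom B' C') (d' : E C' A'),
    in_xi x y d -> etri x' y' d' -> etri_iso x y d x' y' d' ->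
    in_xi x' y' d'
}.

Arguments in_xi : clear implicits.
Arguments in_xi _ {A B C} x y d.

Variable xi : etri_class.

Definition closed_coproducts : Prop :=
  forall A B C A' B' C' (x : hom A B) (y : hom B C) (d : E C A)
    (x' : hom A' B') (y' : hom B' C') (d' : E C' A')
    (SA : biproduct A A') (SB : biproduct B B') (SC : biproduct C C'),
  in_xi xi x y d -> in_xi xi x' y' d' ->
  in_xi xi (biproduct_map SA SB x x') (biproduct_map SB SC y y')
     (ext_sum SC SA d d').

Definition contains_split : Prop :=
  forall A B C (x : hom A B) (y : hom B C),
  etri x y (0 : E C A) -> in_xi xi x y (0 : E C A).

Definition closed_base_change : Prop :=
  forall A B C (x : hom A B) (y : hom B C) (d : E C A)
    C' (c : hom C' C) B' (x' : hom A B') (y' : hom B' C'),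
  in_xi xi x y d -> etri x' y' (pull c d) -> in_xi xi x' y' (pull c d).

Definition closed_cobase_change : Prop :=
  forall A B C (x : hom A B) (y : hom B C) (d : E C A)
    A' (a : hom A A') B' (x' : hom A' B') (y' : hom B' C),
  in_xi xi x y d -> etri x' y' (push a d) -> in_xi xi x' y' (push a d).

Definition saturated : Prop :=
  forall A1 B1 A2 B2 C (x1 : hom A1 B1) (y1 : hom B1 C) (d1 : E C A1)
    (x2 : hom A2 B2) (y2 : hom B2 C) (d2 : E C A2)
    M (m : hom A1 M) (e : hom M B2),
  etri x1 y1 d1 -> in_xi xi x2 y2 d2 -> in_xi xi m e (pull y2 d1) ->
  in_xi xi x1 y1 d1.

Definition proper_class : Prop :=
  [/\ closed_coproducts, contains_split, closed_base_change,
      closed_cobase_change & saturated].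

Definition exact_from W A B C (x : hom A B) (y : hom B C) : Prop :=
  short_exact (postcomp x (A := W)) (postcomp y (A := W)).
Definition exact_to W A B C (x : hom A B) (y : hom B C) : Prop :=
  short_exact (precomp y (B := W)) (precomp x (B := W)).

Definition xi_proj : set cC := [set P |
  forall A B C (x : hom A B) (y : hom B C) (d : E C A),
    in_xi xi x y d -> exact_from P x y].
Definition xi_inj : set cC := [set I |
  forall A B C (x : hom A B) (y : hom B C) (d : E C A),
    in_xi xi x y d -> exact_to I x y].

Definition enough_proj : Prop :=
  forall A, exists K P (x : hom K P) (y : hom P A) (d : E A K),
    in_xi xi x y d /\ xi_proj P.
Definition enough_inj : Prop :=
  forall A, exists I K (x : hom A I) (y : hom I K) (d : E K A),
    in_xi xi x y d /\ xi_inj I.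

Fixpoint resdim_le (W : set cC) (n : nat) A : Prop :=
  match n with
  | 0%N => W A
  | n'.+1 => exists K P (x : hom K P) (y : hom P A) (d : E A K),
      [/\ in_xi xi x y d, W P & resdim_le W n' K]
  end.

Fixpoint coresdim_le (W : set cC) (n : nat) A : Prop :=
  match n with
  | 0%N => W A
  | n'.+1 => exists I K (x : hom A I) (y : hom I K) (d : E K A),
      [/\ in_xi xi x y d, W I & coresdim_le W n' K]
  end.

Definition resdim W A : enat := least (fun n => resdim_le W n A).
Definition coresdim W A : enat := least (fun n => coresdim_le W n A).

Definition xi_pd A : enat := resdim xi_proj A.
Definition xi_id A : enat := coresdim xi_inj A.

Definition finite_pd : set cC := [set A | xi_pd A <> Infty].
Definition finite_id : set cC := [set A | xi_id A <> Infty].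

Definition silp : enat := esup [set xi_id P | P in xi_proj].
Definition spli : enat := esup [set xi_pd I | I in xi_inj].

Definition to_class_exact (W : set cC) A B C (x : hom A B) (y : hom B C) : Prop :=
  forall V, W V -> exact_to V x y.
Definition from_class_exact (W : set cC) A B C (x : hom A B) (y : hom B C) : Prop :=
  forall V, W V -> exact_from V x y.

(* cc_d n is the differential out of degree n + 1, not out of degree n: this
   makes cc_splice well typed without a transport along n - 1 + 1 = n. *)
Record complete_complex (W : set cC)
    (ex : forall A B C, hom A B -> hom B C -> Prop) := CompleteComplex {
  cc_term : int -> cC;
  cc_syz : int -> cC;
  cc_d : forall n : int, hom (cc_term (n + 1)) (cc_term n);
  cc_g : forall n : int, hom (cc_syz (n + 1)) (cc_term n);
  cc_f : forall n : int, hom (cc_term n) (cc_syz n);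
  cc_ext : forall n : int, E (cc_syz n) (cc_syz (n + 1));
  cc_complex : forall n, cc_d n \oc cc_d (n + 1) = 0;
  cc_termW : forall n, W (cc_term n);
  cc_xi : forall n, in_xi xi (cc_g n) (cc_f n) (cc_ext n);
  cc_exact : forall n, ex _ _ _ (cc_g n) (cc_f n);
  cc_splice : forall n, cc_d n = cc_g n \oc cc_f (n + 1)
}.

Definition complete_proj_resolution :=
  complete_complex xi_proj (to_class_exact xi_proj).
Definition complete_inj_coresolution :=
  complete_complex xi_inj (from_class_exact xi_inj).

Definition xi_Gproj : set cC :=
  [set A | exists (R : complete_proj_resolution) (n : int), cc_syz R n = A].
Definition xi_Ginj : set cC :=
  [set A | exists (R : complete_inj_coresolution) (n : int), cc_syz R n = A].

Definition xi_Gpd A : enat := resdim xi_Gproj A.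
Definition xi_Gid A : enat := coresdim xi_Ginj A.

(* K_0 = A holds by conversion, so that the augmentation P_0 -> A needs no
   transport; next n is K_(n+1). *)
Definition syzygy A (next : nat -> cC) (n : nat) : cC :=
  if n is n'.+1 then next n' else A.

Record proj_resolution A := ProjResolution {
  pr_term : nat -> cC;
  pr_next : nat -> cC;
  pr_g : forall n, hom (syzygy A pr_next n.+1) (pr_term n);
  pr_f : forall n, hom (pr_term n) (syzygy A pr_next n);
  pr_ext : forall n, E (syzygy A pr_next n) (syzygy A pr_next n.+1);
  pr_proj : forall n, xi_proj (pr_term n);
  pr_xi : forall n, in_xi xi (pr_g n) (pr_f n) (pr_ext n)
}.

Section Derived.
Variables (A B : cC) (R : proj_resolution A).

Definition pr_d (n : nat) : hom (pr_term R n.+1) (pr_term R n) :=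
  pr_g R n \oc pr_f R n.+1.

Definition pr_aug : hom (pr_term R 0) A := pr_f R 0.

Definition hom_d (n : nat) : {additive hom (pr_term R n) B -> hom (pr_term R n.+1) B} :=
  precomp (pr_d n) (B := B).

Definition hom_d0 : {additive hom (pr_term R 0) B -> hom (pr_term R 0) B} :=
  (\0 : _ -> _).

Definition xixt (n : nat) : zmodType :=
  match n with
  | 0%N => homology hom_d0 (hom_d 0)
  | n'.+1 => homology (hom_d n') (hom_d n'.+1)
  end.

Fact aug_cocycle (h : hom A B) : h \oc pr_aug \in in_ker (hom_d 0).
Proof.
rewrite unfold_in /in_ker /= /precomp /pr_d -compA (compA pr_aug).
by rewrite (etri_comp0 (xi_etri (pr_xi R 0))) comp0m -[h \oc 0]addr0
  -{1}(subrr (h \oc 0)) addrA -compDr addr0 subrr.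
Qed.

Definition xixt0_map (h : hom A B) : xixt 0 :=
  \pi_(homology hom_d0 (hom_d 0))%qT
    (Sub (h \oc pr_aug) (aug_cocycle h) : cycles (hom_d 0)).

End Derived.

(* Neither the vanishing of xixt nor the bijectivity of the natural map depends
   on the resolution R, so quantifying over all R amounts to fixing one. In the
   second half xixt(N, M) is again computed with a projective resolution of the
   first argument. *)
Definition condition_star : Prop :=
  (forall M N (R : proj_resolution M), finite_pd M ->
     (forall i, (1 <= i)%N -> forall u : xixt N R i, u = 0) ->
     bijective (@xixt0_map M N R)) /\
  (forall M N (R : proj_resolution N), finite_id M ->
     (forall i, (1 <= i)%N -> forall u : xixt M R i, u = 0) ->
     bijective (@xixt0_map N M R)).

End ProperClass.

Definition generating (cC : preadditive) (X : set cC) : Prop :=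
  forall A : cC, (forall V, X V -> forall f : hom V A, f = 0) -> is_zero_object A.
Definition cogenerating (cC : preadditive) (Y : set cC) : Prop :=
  forall B : cC, (forall V, Y V -> forall f : hom B V, f = 0) -> is_zero_object B.

(* Main.v *)
From HB Require Import structures.
From mathcomp Require Import all_boot all_order all_algebra.
From mathcomp Require Import boolp classical_sets.
Require Import Defs.

Set Implicit Arguments.
Unset Strict Implicit.
Unset Printing Implicit Defensive.

Import GRing.Theory.
Local Open Scope ring_scope.
Local Open Scope classical_set_scope.

(* Everything rests on the subfunctor E_xi of E formed by the classes of xi:
   C(-, -) and E_xi have the usual exact sequences, and E_xi(K, N) = 0 iff
   E_xi(M, L) = 0 whenever K -> P -> M and N -> I -> L are in xi with P
   xi-projective and I xi-injective, since both groups are C(K, L) / C(P, I).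
   Hence pd M <= n iff E_xi(M, -) vanishes on n-th cosyzygies, and dually.
   (1) => (3): E_xi(M, -) vanishes on the m-th cosyzygies of a xi-projective, so
   its xi-id is at most m; an injective I embeds in some H with pd H <= m and a
   Gorenstein cokernel, and is a summand of H. Two finite bounds for silp and
   spli coincide, because a projective resolution longer than silp splits at its
   end.
   (3) => (1): m-th syzygies are xi-Gprojective. By the horseshoe construction
   applied to M -> I -> M', an m-th syzygy of M embeds in a projective with
   cokernel an m-th syzygy of M'; left exactness of C(-, P) on the resulting
   E-triangles comes from (star), as xixt^i of an m-th syzygy with values in P
   vanishes for i >= 1 by dimension shifting along the injective coresolution
   of P. The statements on injectives follow in the opposite category. *)

(** * The opposite extriangulated category *)

Section Opposite.

(** Objects stay the same and homs are swapped by conversion, so a lemma instantiated at the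
    opposite category is accepted by [exact] as its dual. *)
Definition op_preadditive (cC : preadditive) : preadditive :=
  @Preadditive cC (fun A B => hom B A) (fun A => idm A)
    (fun A B C g f => f \oc g)
    (fun A B f => compm1 f) (fun A B f => comp1m f)
    (fun A B C D h g f => esym (compA f g h))
    (fun A B C g g' f => compDr f g g') (fun A B C g f f' => compDl f f' g).

Definition op_biproduct (cC : preadditive) (A B : cC) (S : biproduct A B) :
  @biproduct (op_preadditive cC) A B :=
  @Biproduct (op_preadditive cC) A B S (prl S) (prr S) (inl S) (inr S)
    (prl_inl S) (prr_inr S) (prr_inl S) (prl_inr S) (bip_id S).

Definition unop_biproduct (cC : preadditive) (A B : cC)
    (S : @biproduct (op_preadditive cC) A B) : biproduct A B :=
  @Biproduct cC A B (bip S) (prl S) (prr S) (inl S) (inr S)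
    (prl_inl S) (prr_inr S) (prr_inl S) (prl_inr S) (bip_id S).

Fact bip_swap_id (cC : preadditive) (A B : cC) (S : biproduct A B) :
  inr S \oc prr S + inl S \oc prl S = idm S.
Proof. by rewrite addrC bip_id. Qed.

Definition bip_swap (cC : preadditive) (A B : cC) (S : biproduct A B) :
  biproduct B A :=
  Biproduct (prr_inr S) (prl_inl S) (prr_inl S) (prl_inr S) (bip_swap_id S).

Fact op_zero_ex (cC : additive_category) :
  exists Z : op_preadditive cC, is_zero_object Z.
Proof. by have [Z [toZ fromZ]] := zero_ex cC; exists Z; split. Qed.

Fact op_biproduct_ex (cC : additive_category) (A B : op_preadditive cC) :
  inhabited (biproduct A B).
Proof. by have [S] := biproduct_ex (A : cC) B; split; apply: op_biproduct. Qed.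

Definition op_additive (cC : additive_category) : additive_category :=
  AdditiveCategory (op_zero_ex cC) (@op_biproduct_ex cC).

Definition op_ext (cC : additive_category) (E : ext_bifunctor cC) :
    ext_bifunctor (op_additive cC) :=
  @ExtBifunctor (op_additive cC) (fun C A => E A C)
    (fun C A A' => @pull cC E A A' C) (fun C C' A => @push cC E A C C')
    (fun C A => @pull1 cC E A C) (fun C A => @push1 cC E A C)
    (fun C A A' A'' a' a => @pullM cC E A A' A'' C a a')
    (fun C C' C'' A c c' => @pushM cC E A C C' C'' c' c)
    (fun C C' A A' a c d => esym (@push_pull cC E A A' C C' c a d))
    (fun C A A' => @pullD cC E A A' C) (fun C C' A => @pushD cC E A C C')
    (fun C A A' => @pull_addm cC E A A' C)
    (fun C C' A => @push_addm cC E A C C').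

Variable cC : extriangulated.
Local Notation E := (ext cC).

Definition op_tri : tri_pred (op_ext E) := fun A B C x y d => etri (e := cC) y x d.

Lemma seq_equiv_sym A C B B' (x : hom A B) (y : hom B C)
    (x' : hom A B') (y' : hom B' C) :
  @seq_equiv cC A C B B' x y x' y' -> @seq_equiv cC A C B' B x' y' x y.
Proof.
case=> b [[g [gb bg]] bx yb]; exists g; split; first by exists b.
  by rewrite -bx compA gb comp1m.
by rewrite -yb -compA bg compm1.
Qed.

Lemma seq_equiv_op A C B B' (x : hom A B) (y : hom B C)
    (x' : hom A B') (y' : hom B' C) :
  @seq_equiv cC A C B B' x y x' y' <->
  @seq_equiv (op_additive cC) C A B B' y x y' x'.
Proof.
split.
  by move=> /seq_equiv_sym[b [[g [gb bg]] bx yb]]; exists b; split=> //; exists g.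
move=> [b [[g [gb bg]] bx yb]]; apply: seq_equiv_sym.
by exists b; split=> //; exists g.
Qed.

Fact op_realization : realization op_tri.
Proof.
have [cls lft] := etri_realization cC; split.
  move=> A C d; have [B [x [y H]]] := cls C A d; exists B, y, x => B' x' y'.
  split=> [/H/seq_equiv_op//|?]; apply/H/seq_equiv_op => //.
move=> A B C A' B' C' x y d x' y' d' a c h h' e.
by have [b [b1 b2]] := lft _ _ _ _ _ _ _ _ _ _ _ _ c a h' h (esym e); exists b.
Qed.

Fact op_additive_realization : additive_realization op_tri.
Proof.
have [spl sm] := etri_additive cC; split=> [A C S|].
  (* Reversing arrows exchanges the two summands of a split sequence. *)
  exact: (spl _ _ (bip_swap (unop_biproduct S))).
move=> A B C A' B' C' x y d x' y' d' SA SB SC h h'.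
have := sm _ _ _ _ _ _ _ _ _ _ _ _ (unop_biproduct SC) (unop_biproduct SB)
  (unop_biproduct SA) h h'.
rewrite /op_tri /biproduct_map /ext_sum /=.
by rewrite !push_pull !compA.
Qed.

Fact op_ET4 : ET4 op_tri.
Proof.
move=> A B C D F f f' del g g' del' h h'.
have [G [k [k' [del'' [d [e [[? ? ? ?] [? ? ?]]]]]]]] := etri_ET4op h h'.
by exists G, k', k, del'', d, e.
Qed.

Fact op_ET4op : ET4op op_tri.
Proof.
move=> A B C D F f f' del g g' del' h h'.
have [G [k [k' [del'' [d [e [[? ? ? ?] [? ? ?]]]]]]]] := etri_ET4 h h'.
by exists G, k', k, del'', d, e.
Qed.

Definition op_extriangulated : extriangulated :=
  @Extriangulated (op_additive cC) (op_ext E) op_tri op_realization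
    op_additive_realization
    (fun A B C A' B' C' x y d x' y' d' a b h h' e =>
       match etri_ET3op h' h (esym e) with
       | ex_intro c (conj e1 e2) => ex_intro _ c (conj (esym e1) (esym e2))
       end)
    (fun A B C A' B' C' x y d x' y' d' b c h h' e =>
       match etri_ET3 h' h (esym e) with
       | ex_intro c (conj e1 e2) => ex_intro _ c (conj (esym e1) (esym e2))
       end)
    op_ET4 op_ET4op.

End Opposite.

(** * Exact sequences *)

Section Exactness.
Variable cC : extriangulated.
Local Notation E := (ext cC).
Implicit Types A B C D M N W : cC.

Lemma compm0 A B C (f : hom B C) : f \oc (0 : hom A B) = 0.
Proof. by apply: (addrI (f \oc 0)); rewrite -compDr !addr0. Qed.

Lemma compmN A B C (f : hom B C) (g : hom A B) : f \oc (- g) = - (f \oc g).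
Proof. by apply: (addrI (f \oc g)); rewrite -compDr !subrr compm0. Qed.

Lemma compNm A B C (f : hom B C) (g : hom A B) : (- f) \oc g = - (f \oc g).
Proof. by apply: (addrI (f \oc g)); rewrite -compDl !subrr comp0m. Qed.

Lemma compBr A B C (f : hom B C) (g h : hom A B) :
  f \oc (g - h) = f \oc g - f \oc h.
Proof. by rewrite compDr compmN. Qed.

Lemma compBl A B C (f g : hom B C) (h : hom A B) :
  (f - g) \oc h = f \oc h - g \oc h.
Proof. by rewrite compDl compNm. Qed.

Lemma pullr0 C C' A (c : hom C' C) : pull c (0 : E C A) = 0.
Proof. by apply: (addrI (pull c 0)); rewrite -pullD !addr0. Qed.

Lemma pushr0 C A A' (a : hom A A') : push a (0 : E C A) = 0.
Proof. by apply: (addrI (push a 0)); rewrite -pushD !addr0. Qed.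

Lemma pull0r C C' A (d : E C A) : pull (0 : hom C' C) d = 0.
Proof. by apply: (addrI (pull 0 d)); rewrite -pull_addm !addr0. Qed.

Lemma push0r C A A' (d : E C A) : push (0 : hom A A') d = 0.
Proof. by apply: (addrI (push 0 d)); rewrite -push_addm !addr0. Qed.

Section Zero.
Variable Z : cC.
Hypothesis Z0 : is_zero_object Z.

Fact zero_bip_prl : (0 : hom Z Z) = idm Z.
Proof. by rewrite (Z0.1 _ (idm Z)). Qed.

Fact zero_bip_id A : (0 : hom Z A) \oc (0 : hom A Z) + idm A \oc idm A = idm A.
Proof. by rewrite comp0m add0r comp1m. Qed.

Definition zero_bip A : biproduct Z A :=
  @Biproduct cC Z A A 0 (idm A) 0 (idm A) (etrans (comp0m _ _) zero_bip_prl)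
    (comp1m _) (comp0m _ _) (comp1m _) (zero_bip_id A).

(** These two trivial conflations serve as sources of morphisms; with them the axioms on morphisms
    yield the exact Hom sequences. *)
Lemma etri_zero_l A : etri (0 : hom Z A) (idm A) 0.
Proof. exact: ((etri_additive cC).1 _ _ (zero_bip A)). Qed.

Lemma etri_zero_r A : etri (idm A) (0 : hom A Z) 0.
Proof. exact: ((etri_additive cC).1 _ _ (bip_swap (zero_bip A))). Qed.

End Zero.

Lemma etri_ex A C (d : E C A) : exists B (x : hom A B) (y : hom B C), etri x y d.
Proof.
have [B [x [y H]]] := (etri_realization cC).1 A C d.
exists B, x, y; apply/H; exists (idm B); split; rewrite ?comp1m ?compm1 //.
by exists (idm B); rewrite comp1m.
Qed.

Lemma seq_equiv_trans A C B B' B'' (x : hom A B) (y : hom B C)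
    (x' : hom A B') (y' : hom B' C) (x'' : hom A B'') (y'' : hom B'' C) :
  @seq_equiv cC A C B B' x y x' y' -> @seq_equiv cC A C B' B'' x' y' x'' y'' ->
  @seq_equiv cC A C B B'' x y x'' y''.
Proof.
move=> [b [[g [gb bg]] bx yb]] [b' [[g' [gb' bg']] bx' yb']].
exists (b' \oc b); split; rewrite -?compA ?bx ?compA ?yb' //.
exists (g \oc g'); split.
  by rewrite -compA (compA g') gb' comp1m.
by rewrite -compA (compA b) bg comp1m.
Qed.

Lemma etri_equiv A B B' C (x : hom A B) (y : hom B C) (x' : hom A B')
    (y' : hom B' C) (d : E C A) :
  etri x y d -> (etri x' y' d <-> seq_equiv x y x' y').
Proof.
have [B0 [x0 [y0 H]]] := (etri_realization cC).1 A C d.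
move=> /H h; split=> [/H h'|h'].
  exact: seq_equiv_trans (seq_equiv_sym h) h'.
by apply/H; apply: seq_equiv_trans h h'.
Qed.

Section Triangle.
Variables (A B C : cC) (x : hom A B) (y : hom B C) (d : E C A).
Hypothesis xyd : etri x y d.

(** The map f is the middle of a morphism from W = W -> 0, which (ET3)^op completes on the left. *)
Lemma factor_infl W (f : hom W B) : y \oc f = 0 -> exists u, x \oc u = f.
Proof.
move=> yf0; have [Z Z0] := zero_ex cC.
have e : (0 : hom Z C) \oc (0 : hom W Z) = y \oc f by rewrite comp0m yf0.
have [u [e1 _]] := etri_ET3op (etri_zero_r Z0 W) xyd e.
by exists u; rewrite -e1 compm1.
Qed.

(** The map c and a zero map form a morphism from the zero class, realized by 0 -> W = W; its lift
    to the middle terms is the required map. *)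
Lemma lift_defl W (c : hom W C) : pull c d = 0 -> exists b, y \oc b = c.
Proof.
move=> cd0; have [Z Z0] := zero_ex cC.
have e : push (0 : hom Z A) 0 = pull c d by rewrite cd0 push0r.
have [b [_ e2]] := (etri_realization cC).2 _ _ _ _ _ _ _ _ _ _ _ _ _ _
  (etri_zero_l Z0 W) xyd e.
by exists b; rewrite e2 compm1.
Qed.

(** A morphism from the split conflation A -> A (+) B -> B with y on the right shows that [pull y d]
    is a pushforward of 0. *)
Lemma pull_defl : pull y d = 0.
Proof.
have [S] := biproduct_ex A B; have spl := (etri_additive cC).1 A B S.
have e : y \oc prr S = y \oc (x \oc prl S + prr S).
  by rewrite compDr compA (etri_comp0 xyd) comp0m add0r.
have [a [_ e2]] := etri_ET3op spl xyd e.
by rewrite -e2 pushr0.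
Qed.

End Triangle.
End Exactness.

Section ExactnessDual.
Variables (cC : extriangulated) (A B C : cC).
Local Notation E := (ext cC).
Variables (x : hom A B) (y : hom B C) (d : E C A).
Hypothesis xyd : etri x y d.

Lemma factor_defl W (f : hom B W) : f \oc x = 0 -> exists u, u \oc y = f.
Proof. exact: (@factor_infl (op_extriangulated cC) _ _ _ y x d xyd). Qed.

Lemma extend_infl W (a : hom A W) : push a d = 0 -> exists b, b \oc x = a.
Proof. exact: (@lift_defl (op_extriangulated cC) _ _ _ y x d xyd). Qed.

Lemma push_infl : push x d = 0.
Proof. exact: (@pull_defl (op_extriangulated cC) _ _ _ y x d xyd). Qed.

End ExactnessDual.

(** * Exactness at the extension group, and isomorphic or summed conflations *)

Section ExtExactness.
Variable cC : extriangulated.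
Local Notation E := (ext cC).
Implicit Types A B C D M N W : cC.

(** This is exactness of C(W, C) -> E(W, A) -> E(W, B): x extends over the middle term of d', and
    (ET3) turns this extension into u. *)
Lemma ext_of_push0 A B C (x : hom A B) (y : hom B C) (d : E C A)
    W (d' : E W A) :
  etri x y d -> push x d' = 0 -> exists u, d' = pull u d.
Proof.
move=> xyd; have [B' [x' [y' xyd']]] := etri_ex d' => xd'.
have [v e] := extend_infl xyd' xd'.
have e' : v \oc x' = x \oc idm A by rewrite e compm1.
have [c [_ ec]] := etri_ET3 xyd' xyd e'.
by exists c; rewrite -ec push1.
Qed.

(* Such an endomorphism differs from the identity by a map of square zero. *)
Lemma etri_endo_iso A B C (x : hom A B) (y : hom B C) (d : E C A) (b : hom B B) :
  etri x y d -> b \oc x = x -> y \oc b = y -> is_iso b.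
Proof.
move=> xyd bx yb; set n := b - idm B.
have [u xu] : exists u, x \oc u = n.
  by apply: (factor_infl xyd); rewrite compBr yb compm1 subrr.
have nn : n \oc n = 0.
  by rewrite -{2}xu compA compBl bx comp1m subrr comp0m.
have -> : b = idm B + n by rewrite addrC subrK.
clearbody n; exists (idm B - n); split.
  by rewrite compBl !compDr nn compm1 compm1 comp1m addr0 addrK.
by rewrite compBr !compDl nn compm1 comp1m compm1 addr0 addrK.
Qed.

Lemma is_iso_two_sided A B (b : hom A B) (g : hom B A) :
  is_iso (g \oc b) -> is_iso (b \oc g) -> is_iso b.
Proof.
move=> [p [p1 _]] [q [_ q2]]; have l : (p \oc g) \oc b = idm A by rewrite -compA.
have r : b \oc (g \oc q) = idm B by rewrite compA.
exists (p \oc g); split=> //.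
have -> : p \oc g = g \oc q by rewrite -[LHS]compm1 -r compA l comp1m.
by [].
Qed.

(** The lifts of (1, c) and (1, c') to the middle terms compose both ways to isomorphisms by
    [etri_endo_iso], so the sequence is equivalent to a realization of [pull c' d]. *)
Lemma etri_iso_cocone A B C C' (x : hom A B) (y : hom B C) (d : E C A)
    (c : hom C C') (c' : hom C' C) :
  etri x y d -> c' \oc c = idm C -> c \oc c' = idm C' ->
  etri x (c \oc y) (pull c' d).
Proof.
move=> xyd c'c cc'; have [B' [x' [y' xyd']]] := etri_ex (pull c' d).
have lft := (etri_realization cC).2.
have e1 : push (idm A) d = pull c (pull c' d) by rewrite push1 -pullM c'c pull1.
have [b [bx yb]] := lft _ _ _ _ _ _ _ _ _ _ _ _ _ _ xyd xyd' e1.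
have e2 : push (idm A) (pull c' d) = pull c' d by rewrite push1.
have [g [gx yg]] := lft _ _ _ _ _ _ _ _ _ _ _ _ _ _ xyd' xyd e2.
rewrite !compm1 in bx gx.
have isob : is_iso b.
  apply: (@is_iso_two_sided _ _ b g).
    apply: (etri_endo_iso xyd); first by rewrite -compA bx gx.
    by rewrite compA yg -compA yb compA c'c comp1m.
  apply: (etri_endo_iso xyd'); first by rewrite -compA gx bx.
  by rewrite compA yb -compA yg compA cc' comp1m.
by apply/(etri_equiv _ _ xyd'); apply: seq_equiv_sym; exists b.
Qed.

(** Add D = D -> 0 to the given triangle; [zero_bip] makes C itself the biproduct of 0 and C, so the
    third term stays C. *)
Lemma etri_biproduct_id A B C D (x : hom A B) (y : hom B C) (d : E C A)
    (SA : biproduct D A) (SB : biproduct D B) :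
  etri x y d ->
  etri (biproduct_map SA SB (idm D) x) (y \oc prr SB) (push (inr SA) d).
Proof.
move=> xyd; have [Z Z0] := zero_ex cC.
have := (etri_additive cC).2 _ _ _ _ _ _ _ _ _ _ _ _ SA SB (zero_bip Z0 C)
  (etri_zero_r Z0 D) xyd.
rewrite /biproduct_map /ext_sum /= !comp0m add0r !comp1m.
by rewrite pullr0 pushr0 add0r pull1.
Qed.

Section ShearedBiproduct.
Variables (A D : cC) (a : hom A D) (S : biproduct D A).
Let i := inr S - inl S \oc a.
Let q := prl S + a \oc prr S.

Fact shear_prl_inl : prr S \oc i = idm A.
Proof. by rewrite compBr compA prr_inl comp0m subr0 prr_inr. Qed.

Fact shear_prr_inr : q \oc inl S = idm D.
Proof. by rewrite compDl -compA prr_inl compm0 addr0 prl_inl. Qed.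

Fact shear_prr_inl : q \oc i = 0.
Proof.
rewrite compBr compDl -compA prr_inr compm1 prl_inr add0r compA.
by rewrite shear_prr_inr comp1m subrr.
Qed.

Fact shear_id : i \oc prr S + inl S \oc q = idm S.
Proof.
by rewrite compBl compDr compA addrACA addNr addr0 -[RHS](bip_id S) addrC.
Qed.

(** The split conflation of this biproduct has the graph of - a as inflation and the map (1, a) as
    deflation. *)
Definition shear : biproduct A D :=
  @Biproduct cC A D S i (inl S) (prr S) q shear_prl_inl shear_prr_inr
    (prr_inl S) shear_prr_inl shear_id.

End ShearedBiproduct.
End ExtExactness.

(** * Conflations from pushouts and pullbacks *)

Section Pushout.
Variable cC : extriangulated.
Local Notation E := (ext cC).
Implicit Types A B C D : cC.

(* (ET4) applied to the composite A -> D (+) A -> D (+) B of the inflation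
   (- a, 1) and of 1 (+) x. *)
Lemma pushout_conflation A B C (x : hom A B) (y : hom B C) (d : E C A)
    D (a : hom A D) G (u : hom D G) (v : hom G C) :
  etri x y d -> etri u v (push a d) ->
  exists (S : biproduct D B) (h : hom A S) (h' : hom S G), etri h h' (pull v d).
Proof.
move=> xyd uv; have [SA] := biproduct_ex D A; have [SB] := biproduct_ex D B.
have t1 := (etri_additive cC).1 _ _ (shear a SA).
have t2 := etri_biproduct_id SA SB xyd.
have [G' [h [h' [d'' [u' [v' [[hh' _ _ _] [uv' _ e]]]]]]]] := etri_ET4 t1 t2.
(* The deflation (1, a) restricts to a on A, so the conflation of cokernels from (ET4) realizes
   [push a d] and can be compared with u, v. *)
have pe : push (prr (shear a SA)) (push (inr SA) d) = push a d.
  by rewrite -pushM /= compDl prl_inr add0r -compA prr_inr compm1.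
rewrite pe in uv'.
have [b [[g [gb bg]] _ vb]] := (etri_equiv _ _ uv').1 uv.
have -> : pull v d = pull g d''.
  (* Projecting the compatibility [e] back onto A recovers d'' itself. *)
  have -> : d'' = pull v' d.
    rewrite -[LHS]push1 -(shear_prl_inl a SA) pushM e push_pull -pushM.
    by rewrite prr_inr push1.
  by rewrite -pullM -vb -compA bg compm1.
by exists SB, h, (b \oc h'); apply: etri_iso_cocone hh' gb bg.
Qed.
End Pushout.

Lemma pullback_conflation (cC : extriangulated) (A B C : cC) (x : hom A B)
    (y : hom B C) (d : ext cC C A) (D : cC) (c : hom D C) (G : cC)
    (u : hom A G) (v : hom G D) :
  etri x y d -> etri u v (pull c d) ->
  exists (S : biproduct D B) (h : hom G S) (h' : hom S C), etri h h' (push u d).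
Proof.
move=> xyd uv.
have [S [h [h' hh']]] :=
  @pushout_conflation (op_extriangulated cC) _ _ _ y x d _ c _ v u xyd uv.
by exists (unop_biproduct S), h', h.
Qed.

(** * Proper classes *)

Section ProperClasses.
Variable cC : extriangulated.
Local Notation E := (ext cC).
Implicit Types A B C D F G I K L M N P W : cC.

(** The mirror image of [saturated], with a cobase change along the inflation of d in place of a
    base change along a deflation. *)
Definition cosaturated (xi : etri_class cC) : Prop :=
  forall A B C D M (x : hom A B) (y : hom B D) (d : E D A) (d1 : E C A)
    (m : hom B M) (e : hom M C),
  in_xi xi x y d -> in_xi xi m e (push x d1) ->
  forall B1 (x1 : hom A B1) (y1 : hom B1 C), etri x1 y1 d1 -> in_xi xi x1 y1 d1.

(* A self-dual variant of [proper_class], so that it passes to [op_class]. *)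
Record proper (xi : etri_class cC) : Prop := Proper {
  proper_split : contains_split xi;
  proper_pull : closed_base_change xi;
  proper_push : closed_cobase_change xi;
  proper_sat : saturated xi;
  proper_cosat : cosaturated xi
}.

(** For cosaturation, e is the deflation of [push x d1], so x kills [pull e d1], which is therefore
    a base change of d and lies in xi; saturation along e then gives d1. *)
Lemma proper_class_proper (xi : etri_class cC) : proper_class xi -> proper xi.
Proof.
move=> [_ spl pul psh sat]; split=> //.
move=> A B C D M x y d d1 m e xyd med B1 x1 y1 xyd1.
have [u eu] : exists u, pull e d1 = pull u d.
  apply: (ext_of_push0 (xi_etri xyd)).
  by rewrite push_pull (pull_defl (xi_etri med)).
have [N [n [n' nn']]] := etri_ex (pull e d1).
apply: (sat _ _ _ _ _ _ _ _ _ _ _ _ n n' xyd1 med).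
by move: nn'; rewrite eu => nn'; apply: pul xyd nn'.
Qed.

End ProperClasses.

Section OppositeClass.
Variables (cC : extriangulated) (xi : etri_class cC).
Local Notation opC := (op_extriangulated cC).

Definition op_in_xi : tri_pred (ext opC) :=
  fun A B C x y d => @in_xi cC xi C B A y x d.

Fact op_xi_etri (A B C : opC) (x : hom A B) (y : hom B C) (d : ext opC C A) :
  op_in_xi x y d -> etri x y d.
Proof. exact: (@xi_etri _ xi C B A y x d). Qed.

Lemma iso_square (A B A' B' : cC) (x : hom A B) (x' : hom A' B')
    (a : hom A' A) (a' : hom A A') (b : hom B' B) (b' : hom B B') :
  a \oc a' = idm A -> b' \oc b = idm B' -> x \oc a = b \oc x' ->
  b' \oc x = x' \oc a'.
Proof.
by move=> aa' b'b e; rewrite -[x]compm1 -aa' (compA x) e -(compA b) compA b'b comp1m.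
Qed.

Lemma etri_iso_unop (A B C A' B' C' : cC) (x : hom A B) (y : hom B C)
    (d : ext cC C A) (x' : hom A' B') (y' : hom B' C') (d' : ext cC C' A') :
  @etri_iso opC C B A C' B' A' y x d y' x' d' -> etri_iso x y d x' y' d'.
Proof.
move=> [c [b [a [[[c' [cc' c'c]] [b' [bb' b'b]] [a' [aa' a'a]]] [e1 e2 e3]]]]].
rewrite /= in a b c a' b' c' aa' a'a bb' b'b cc' c'c e1 e2 e3.
exists a', b', c'; split; first by split; [exists a | exists b | exists c].
split; [exact: iso_square aa' b'b e2 | exact: iso_square bb' c'c e1 |].
by rewrite -[d in LHS]pull1 -cc' pullM e3 push_pull -pushM a'a push1.
Qed.

Fact op_xi_iso (A B C A' B' C' : opC) (x : hom A B) (y : hom B C)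
    (d : ext opC C A) (x' : hom A' B') (y' : hom B' C') (d' : ext opC C' A') :
  op_in_xi x y d -> etri x' y' d' -> etri_iso x y d x' y' d' -> op_in_xi x' y' d'.
Proof. by move=> h h' /etri_iso_unop; apply: (xi_iso h h'). Qed.

Definition op_class : etri_class opC := EtriClass op_xi_etri op_xi_iso.

Lemma op_class_proper : proper xi -> proper op_class.
Proof.
case=> spl pul psh sat cosat; split.
- by move=> A B C x y; apply: spl.
- by move=> A B C x y d A' a B' x' y'; apply: psh.
- by move=> A B C x y d A' a B' x' y'; apply: pul.
- move=> A1 B1 A2 B2 C x1 y1 d1 x2 y2 d2 M m e h h2 hm.
  by apply: cosat h2 hm _ _ _ h.
- move=> A B C D M x y d d1 m e h hm B1 x1 y1 h1.
  by apply: sat h1 h hm.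
Qed.

Lemma op_enough_proj : enough_inj xi -> enough_proj op_class.
Proof.
move=> eI A; have [I [K [x [y [d [xyd Iinj]]]]]] := eI A.
by exists K, I, y, x, d; split=> // ? ? ? ? ? ? h; apply: Iinj h.
Qed.

Lemma op_enough_inj : enough_proj xi -> enough_inj op_class.
Proof.
move=> eP A; have [K [P [x [y [d [xyd Pproj]]]]]] := eP A.
by exists P, K, y, x, d; split=> // ? ? ? ? ? ? h; apply: Pproj h.
Qed.

Lemma op_xi_proj : xi_proj op_class = xi_inj xi.
Proof. by apply/seteqP; split=> I h A B C x y d xyd; apply: h xyd. Qed.

Lemma op_xi_inj : xi_inj op_class = xi_proj xi.
Proof. by apply/seteqP; split=> I h A B C x y d xyd; apply: h xyd. Qed.

Lemma op_resdim_le (W : set cC) n A :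
  @resdim_le opC op_class W n A <-> coresdim_le xi W n A.
Proof.
elim: n A => [|n IH] A //=; split.
  by move=> [K [P [x [y [d [xyd WP /IH h]]]]]]; exists P, K, y, x, d.
by move=> [P [K [x [y [d [xyd WP /IH h]]]]]]; exists K, P, y, x, d.
Qed.

Lemma op_coresdim_le (W : set cC) n A :
  @coresdim_le opC op_class W n A <-> resdim_le xi W n A.
Proof.
elim: n A => [|n IH] A //=; split.
  by move=> [K [P [x [y [d [xyd WP /IH h]]]]]]; exists P, K, y, x, d.
by move=> [P [K [x [y [d [xyd WP /IH h]]]]]]; exists K, P, y, x, d.
Qed.

End OppositeClass.

(** * Relative extensions *)

Section XiExact.
Variables (cC : extriangulated) (xi : etri_class cC).
Local Notation E := (ext cC).
Implicit Types A B C D F G H I K L M N P W X Z : cC.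

Definition xitri A B C : Prop :=
  exists (x : hom A B) (y : hom B C) (d : E C A), in_xi xi x y d.

(* E_xi(M, N) = 0 *)
Definition xivan M N : Prop :=
  forall B (x : hom N B) (y : hom B M) (d : E M N), in_xi xi x y d -> d = 0.

Hypothesis xiP : proper xi.

Lemma xivan_pull A B C W (x : hom A B) (y : hom B C) (d : E C A) (c : hom W C) :
  in_xi xi x y d -> xivan W A -> pull c d = 0.
Proof.
move=> xyd van; have [B' [x' [y' xyd']]] := etri_ex (pull c d).
exact: van (proper_pull xiP xyd xyd').
Qed.

Lemma xivan_push A B C W (x : hom A B) (y : hom B C) (d : E C A) (a : hom A W) :
  in_xi xi x y d -> xivan C W -> push a d = 0.
Proof.
move=> xyd van; have [B' [x' [y' xyd']]] := etri_ex (push a d).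
exact: van (proper_push xiP xyd xyd').
Qed.

Lemma xitri_pull A B C W (x : hom A B) (y : hom B C) (d : E C A) (c : hom W C) :
  in_xi xi x y d -> exists D (u : hom A D) (v : hom D W), in_xi xi u v (pull c d).
Proof.
move=> xyd; have [D [u [v uv]]] := etri_ex (pull c d).
by exists D, u, v; apply: (proper_pull xiP) xyd uv.
Qed.

(** In (ET4) the conflation of cokernels is a cobase change of the second triangle. The composite
    lies in xi by cosaturation, its pushforward along f being a base change of the second
    triangle. *)
Lemma xitri_comp A B C D F :
  xitri A B D -> xitri B C F -> exists G, xitri A C G /\ xitri D G F.
Proof.
move=> [f [f' [del tf]]] [g [g' [del' tg]]].
have [G [h [h' [del'' [d [e [[hh' _ _ _] [de _ eq]]]]]]]] :=
  etri_ET4 (xi_etri tf) (xi_etri tg).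
exists G; split; last first.
  by exists d, e, (push f' del'); apply: (proper_push xiP) tg de.
exists h, h', del''; have [N [u [v uv]]] := xitri_pull e tg.
by apply: (proper_cosat xiP) tf _ _ _ _ hh'; rewrite eq; apply: uv.
Qed.

Lemma xitri_biproduct_id P G G' G'' (S : biproduct P G) :
  xitri G G' G'' -> exists S' : biproduct P G', xitri S S' G''.
Proof.
move=> [x [y [d xyd]]]; have [S'] := biproduct_ex P G'; exists S'.
have := etri_biproduct_id S S' (xi_etri xyd) => t.
by do 3!eexists; apply: (proper_push xiP) xyd t.
Qed.

(** The vanishing makes the class of K -> H -> G a base change of that of K -> P -> Z along some u :
    G -> Z. The pullback gives H -> G (+) P -> Z, and composing with the inflation of G (+) P into P
    (+) P' gives both triangles. *)
Lemma horseshoe_infl K P Z H G P' G' :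
  xitri K P Z -> xitri K H G -> xitri G P' G' -> xivan G P ->
  exists (S : biproduct P P') (X : cC), xitri H S X /\ xitri Z X G'.
Proof.
move=> [k [p [w tw]]] [i [q [c tc]]] tG van.
have [u eu] : exists u, c = pull u w.
  exact: (ext_of_push0 (xi_etri tw)) (xivan_push k tc van).
rewrite {}eu in tc.
have [S [h [h' hh']]] := pullback_conflation (xi_etri tw) (xi_etri tc).
have tS : xitri H S Z by do 3!eexists; apply: (proper_push xiP) tw hh'.
have [S' tS'] := xitri_biproduct_id (bip_swap S) tG.
by exists S'; apply: xitri_comp tS tS'.
Qed.

(** A class on M vanishes on G, so it is [push v w] for some v : K -> L'. This v lifts to I, and the
    lift extends to G by injectivity; hence v factors through k, which kills w. *)
Lemma xivan_shift K G M L I L' :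
  xitri K G M -> xitri L I L' -> xi_inj xi I -> xivan K L -> xivan G L' ->
  xivan M L'.
Proof.
move=> [k [g [w tw]]] [i [q [l tl]]] Iinj vKL vGL' B x y d xyd.
have gd : pull g d = 0 by apply: (xivan_pull _ xyd).
have [v ->] := @ext_of_push0 (op_extriangulated cC) _ _ _ g k w _ d (xi_etri tw) gd.
have [f <-] := lift_defl (xi_etri tl) (xivan_pull v tl vKL).
have [_ _ /(_ f)[f' <-]] := Iinj _ _ _ _ _ _ tw.
by rewrite /= compA pushM (push_infl (xi_etri tw)) pushr0.
Qed.

Lemma xi_proj_of_retract P Q (r : hom Q P) (s : hom P Q) :
  xi_proj xi Q -> r \oc s = idm P -> xi_proj xi P.
Proof.
move=> Qproj rs A B C x y d xyd; have [inj ex sur] := Qproj _ _ _ _ _ _ xyd.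
have rsK X (f : hom P X) : f \oc r \oc s = f by rewrite -compA rs compm1.
split.
- move=> f f' /(congr1 (fun h => h \oc r)); rewrite /= /postcomp -!compA.
  by move=> /inj /(congr1 (fun h => h \oc s)); rewrite !rsK.
- move=> f; split=> [yf|[u <-]]; last first.
    by rewrite /postcomp compA (etri_comp0 (xi_etri xyd)) comp0m.
  have [u eu] := factor_infl (xi_etri xyd) yf.
  by exists u.
- move=> f; have [u] := sur (f \oc r); rewrite /postcomp => eu.
  by exists (u \oc s); rewrite /postcomp compA eu rsK.
Qed.

Lemma xi_projP : enough_proj xi ->
  forall P, xi_proj xi P <-> (forall N, xivan P N).
Proof.
move=> eP P; split=> [Pproj N B x y d xyd|van].
  have [_ _ /(_ (idm P))[s]] := Pproj _ _ _ _ _ _ xyd; rewrite /postcomp => ys.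
  by rewrite -[d]pull1 -ys pullM (pull_defl (xi_etri xyd)) pullr0.
have [K [Q [x [y [d [xyd Qproj]]]]]] := eP P.
have d0 : pull (idm P) d = 0 by apply: (xivan_pull _ xyd).
have [s ys] := lift_defl (xi_etri xyd) d0.
exact: xi_proj_of_retract Qproj ys.
Qed.

Lemma xi_proj_biproduct : enough_proj xi ->
  forall P P' (S : biproduct P P'), xi_proj xi P -> xi_proj xi P' -> xi_proj xi S.
Proof.
move=> /xi_projP prP P P' S /prP vP /prP vP'; apply/prP => N B x y d xyd.
rewrite -[d]pull1 -(bip_id S) pull_addm !pullM.
by rewrite (xivan_pull _ xyd) // (xivan_pull _ xyd) // !pullr0 addr0.
Qed.

End XiExact.

Section Dual.
Variables (cC : extriangulated) (xi : etri_class cC).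
Implicit Types A B C D F G H I K L M N P W X Z : cC.
Local Notation opC := (op_extriangulated cC).
Local Notation opxi := (op_class xi).

Lemma op_xitri A B C : @xitri opC opxi C B A <-> xitri xi A B C.
Proof. by split=> -[x [y [d h]]]; exists y, x, d. Qed.

Lemma op_xivan M N : @xivan opC opxi N M <-> xivan xi M N.
Proof. by split=> h B x y d /h. Qed.

Hypothesis xiP : proper xi.

Lemma xi_injP : enough_inj xi -> forall I, xi_inj xi I <-> (forall M, xivan xi M I).
Proof.
move=> eI I; rewrite -op_xi_proj.
rewrite (xi_projP (op_class_proper xiP) (op_enough_proj eI)).
by split=> h N; apply/op_xivan; apply: h.
Qed.

(** The dual of [xivan_shift]. For P projective and I injective the two together make the vanishing
    of E_xi(L', M) and of E_xi(L, K) equivalent. *)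
Lemma xivan_unshift K I M L P L' :
  xitri xi M I K -> xitri xi L' P L -> xi_proj xi P -> xivan xi L K ->
  xivan xi L' I -> xivan xi L' M.
Proof.
rewrite -op_xi_inj => /op_xitri t1 /op_xitri t2 Pproj /op_xivan v1 /op_xivan v2.
by apply/op_xivan; apply: (xivan_shift (op_class_proper xiP)) t1 t2 Pproj v1 v2.
Qed.

Lemma horseshoe_defl K P Z H G P' G' :
  xitri xi Z P K -> xitri xi G H K -> xitri xi G' P' G -> xivan xi P G ->
  exists (S : biproduct P P') (X : cC), xitri xi X S H /\ xitri xi G' X Z.
Proof.
move=> /op_xitri t1 /op_xitri t2 /op_xitri t3 /op_xivan van.
have [S [X [/op_xitri ? /op_xitri ?]]] :=
  horseshoe_infl (op_class_proper xiP) t1 t2 t3 van.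
by exists (unop_biproduct S), X.
Qed.

End Dual.

(** * Syzygies and dimensions *)

Section Syzygies.
Variables (cC : extriangulated) (xi : etri_class cC).
Implicit Types (A B C F G H I K L M N P W X Z : cC) (S T : set cC).

Fixpoint syz S n W : Prop :=
  if n is n'.+1 then
    exists W' P, [/\ xitri xi W P W', xi_proj xi P & syz S n' W']
  else S W.

Fixpoint cosyz S n L : Prop :=
  if n is n'.+1 then
    exists L' I, [/\ xitri xi L' I L, xi_inj xi I & cosyz S n' L']
  else S L.

Lemma syz_subset S T n : S `<=` T -> syz S n `<=` syz T n.
Proof.
move=> sST; elim: n => [|n IH] W //=; first exact: sST.
by move=> [W' [P [t Pp /IH h]]]; exists W', P.
Qed.

(** The recursion of [syz] removes the step next to W; inductions along a resolution need the step
    next to the resolved object. *)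
Lemma syzSr S n W : syz S n.+1 W <->
  exists M K P, [/\ S M, xitri xi K P M, xi_proj xi P & syz [set K] n W].
Proof.
elim: n W => [|n IH] W.
  split=> [[W' [P [t Pp SW']]]|[M [K [P [SM t Pp ->]]]]]; first by exists W', W, P.
  by exists M, P.
split=> [[W' [P [t Pp /IH[M [K [P' [SM t' Pp' h]]]]]]]|].
  by exists M, K, P'; split=> //; exists W', P.
move=> [M [K [P [SM t Pp [W' [P' [t' Pp' h]]]]]]].
by exists W', P'; split=> //; apply/IH; exists M, K, P.
Qed.

Lemma syz_setTW n k W : syz setT (n + k) W -> syz setT n W.
Proof.
elim: n W => [//|n IH] W /= [W' [P [t Pp h]]].
by exists W', P; split=> //; apply: IH.
Qed.

Lemma resdim_leS S n M : resdim_le xi S n.+1 M <->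
  exists K P, [/\ xitri xi K P M, S P & resdim_le xi S n K].
Proof.
split=> [[K [P [x [y [d [h SP r]]]]]]|[K [P [[x [y [d h]]] SP r]]]].
  by exists K, P; split=> //; exists x, y, d.
by exists K, P, x, y, d.
Qed.

Lemma resdim_le_of_syz S : enough_proj xi -> xi_proj xi `<=` S ->
  forall n M, (forall W, syz [set M] n W -> S W) -> resdim_le xi S n M.
Proof.
move=> eP sPS; elim=> [|n IH] M h; first exact: h.
have [K [P [x [y [d [xyd Pp]]]]]] := eP M; apply/resdim_leS; exists K, P.
split; [by exists x, y, d | exact: (sPS _ Pp) | apply: IH => W hW].
by apply: h; apply/syzSr; exists M, K, P; split=> //; exists x, y, d.
Qed.

End Syzygies.

Section Dimensions.
Variables (cC : extriangulated) (xi : etri_class cC).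
Implicit Types (A B C F G H I K L M N P W X Z : cC) (S T : set cC).
Local Notation opC := (op_extriangulated cC).
Local Notation opxi := (op_class xi).

Lemma op_cosyz S n L : @cosyz opC opxi S n L <-> syz xi S n L.
Proof.
elim: n L => [//|n IH] L /=; rewrite op_xi_inj; split.
  by move=> [W [P [/op_xitri t Pp /IH h]]]; exists W, P.
by move=> [W [P [/op_xitri t Pp /IH h]]]; exists W, P.
Qed.

Lemma op_syz S n W : @syz opC opxi S n W <-> cosyz xi S n W.
Proof.
elim: n W => [//|n IH] W /=; rewrite op_xi_proj; split.
  by move=> [L [P [/op_xitri t Pp /IH h]]]; exists L, P.
by move=> [L [P [/op_xitri t Pp /IH h]]]; exists L, P.
Qed.

Lemma cosyz_setTW n k L : cosyz xi setT (n + k) L -> cosyz xi setT n L.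
Proof. by move=> /op_syz/syz_setTW/op_syz. Qed.

Hypotheses (xiP : proper xi) (eP : enough_proj xi) (eI : enough_inj xi).

Lemma xi_inj_coresdim_le n N :
  (forall L, cosyz xi [set N] n L -> xi_inj xi L) -> coresdim_le xi (xi_inj xi) n N.
Proof.
move=> h; apply/op_resdim_le; apply: resdim_le_of_syz (op_enough_proj eI) _ _ _ _.
  by rewrite op_xi_proj.
by move=> W /op_syz; apply: h.
Qed.

Lemma xi_proj_van P N : xi_proj xi P -> xivan xi P N.
Proof. by move=> /(xi_projP xiP eP); apply. Qed.

Lemma xi_inj_van M I : xi_inj xi I -> xivan xi M I.
Proof. by move=> /(xi_injP xiP eI); apply. Qed.

(** The right side mentions no chosen resolution, so monotonicity in n and independence of the
    chosen syzygies follow from it. *)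
Lemma pd_leP n M : resdim_le xi (xi_proj xi) n M <->
  (forall L, cosyz xi setT n L -> xivan xi M L).
Proof.
elim: n M => [|n IH] M.
  by split=> [/(xi_projP xiP eP)h L _|h] //; apply/(xi_projP xiP eP) => N; apply: h.
rewrite resdim_leS; split.
  move=> [K [P [t Pp /IH h]]] L [L' [I [t' Ii /h h']]].
  by apply: (xivan_shift xiP t t' Ii h'); apply: xi_proj_van.
move=> h; have [K [P [x [y [d [xyd Pp]]]]]] := eP M.
have t : xitri xi K P M by exists x, y, d.
exists K, P; split=> //; apply/IH => L' hL'.
have [I [L [x' [y' [d' [xyd' Ii]]]]]] := eI L'.
have t' : xitri xi L' I L by exists x', y', d'.
apply: (xivan_unshift xiP t' t Pp); last exact: xi_inj_van.
by apply: h; exists L', I.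
Qed.

Lemma pd_le_leq n k M : (n <= k)%N ->
  resdim_le xi (xi_proj xi) n M -> resdim_le xi (xi_proj xi) k M.
Proof.
move=> /subnKC <- /pd_leP h; apply/pd_leP => L hL; apply: h.
exact: cosyz_setTW hL.
Qed.

Lemma pd_le_syz n K P M : xitri xi K P M -> xi_proj xi P ->
  resdim_le xi (xi_proj xi) n M -> resdim_le xi (xi_proj xi) n.-1 K.
Proof.
move=> t Pp h; apply/pd_leP => L' hL'.
have [I [L [x' [y' [d' [xyd' Ii]]]]]] := eI L'.
have t' : xitri xi L' I L by exists x', y', d'.
apply: (xivan_unshift xiP t' t Pp); last exact: xi_inj_van.
(* The bound [n.-1.+1] is n, except that it is 1 for n = 0. *)
have : resdim_le xi (xi_proj xi) n.-1.+1 M by apply: pd_le_leq h; case: (n).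
by move=> /pd_leP; apply; exists L', I.
Qed.

(** Injectivity makes I a retract of H, and vanishing of E_xi(-, L) passes to retracts. *)
Lemma pd_le_inj n I H X : xitri xi I H X -> xi_inj xi I ->
  resdim_le xi (xi_proj xi) n H -> resdim_le xi (xi_proj xi) n I.
Proof.
move=> [x [y [d xyd]]] Ii /pd_leP h; apply/pd_leP => L /h van B u v e uve.
have [_ _ /(_ (idm I))[r]] := Ii _ _ _ _ _ _ xyd; rewrite /precomp => rx.
by rewrite -[e]pull1 -rx pullM (xivan_pull xiP _ uve) // pullr0.
Qed.

(** Embedding N in an injective I with cokernel L writes a class as [pull u l], and it suffices to
    lift u to I: first on G1, then, after subtracting an extension of that lift, on G2. The classes
    met on the way are base changes of l, hence lie in xi. *)
Lemma xivan_ext G1 X G2 N :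
  xitri xi G1 X G2 -> xivan xi G1 N -> xivan xi G2 N -> xivan xi X N.
Proof.
move=> [g [p [w tw]]] v1 v2 B x y d xyd.
have [I [L [i [q [l [tl Ii]]]]]] := eI N.
have [u du] : exists u, d = pull u l.
  exact: (ext_of_push0 (xi_etri tl)) (xivan_push xiP i xyd (xi_inj_van Ii)).
have [f ef] : exists f, q \oc f = u \oc g.
  by apply: (lift_defl (xi_etri tl)); rewrite pullM -du (xivan_pull xiP _ xyd).
have [_ _ /(_ f)[f' ef']] := Ii _ _ _ _ _ _ tw.
have [v ev] : exists v, v \oc p = u - q \oc f'.
  apply: (factor_defl (xi_etri tw)); rewrite compBl -ef -compA.
  by rewrite -[f' \oc g]/(precomp g f') ef' subrr.
have [v' ev'] := lift_defl (xi_etri tl) (xivan_pull xiP v tl v2).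
have -> : d = pull (q \oc (v' \oc p + f')) l.
  by rewrite compDr compA ev' ev subrK.
by rewrite pullM (pull_defl (xi_etri tl)) pullr0.
Qed.

Lemma xivan_of_extend A B C (x : hom A B) (y : hom B C) (d : ext cC C A) N :
  in_xi xi x y d -> xivan xi B N ->
  (forall a : hom A N, exists b, b \oc x = a) -> xivan xi C N.
Proof.
move=> xyd van sur B' x' y' e xye.
have ye : pull y e = 0 by apply: (xivan_pull xiP _ xye).
have [v ->] := @ext_of_push0 opC _ _ _ y x d _ e (xi_etri xyd) ye.
have [b <-] := sur v.
by rewrite /= pushM (push_infl (xi_etri xyd)) pushr0.
Qed.

End Dimensions.

Section DimensionsDual.
Variables (cC : extriangulated) (xi : etri_class cC).
Implicit Types (A B C F G H I K L M N P W X Z : cC) (S T : set cC).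
Hypotheses (xiP : proper xi) (eP : enough_proj xi) (eI : enough_inj xi).

Lemma id_leP n N : coresdim_le xi (xi_inj xi) n N <->
  (forall W, syz xi setT n W -> xivan xi W N).
Proof.
rewrite -op_resdim_le -op_xi_proj.
rewrite (pd_leP (op_class_proper xiP) (op_enough_proj eI) (op_enough_inj eP)).
by split=> h W /op_cosyz /h /op_xivan.
Qed.

(** The number j counts the syzygies already taken. When n reaches 0, M is a j-th syzygy with t <= j
    and K is projective, so the last conflation splits. *)
Lemma pd_le_descend t : (forall P, xi_proj xi P -> coresdim_le xi (xi_inj xi) t P) ->
  forall n j M, (t <= n + j)%N -> syz xi setT j M ->
  resdim_le xi (xi_proj xi) n.+1 M -> resdim_le xi (xi_proj xi) n M.
Proof.
move=> idP; elim=> [|n IH] j M tnj hM /resdim_leS[K [P [tri Pp hK]]].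
  have van : xivan xi M K.
    move/id_leP: (idP _ hK); apply; apply: (@syz_setTW _ _ _ (j - t)).
    by rewrite subnKC.
  have [x [y [d xyd]]] := tri.
  have d0 : pull (idm M) d = 0 by rewrite (van _ _ _ _ xyd) pullr0.
  have [s ys] := lift_defl (xi_etri xyd) d0.
  exact: xi_proj_of_retract Pp ys.
apply/resdim_leS; exists K, P; split=> //; apply: (IH j.+1) hK.
  by rewrite addnS -addSn.
by exists M, P.
Qed.

Lemma pd_le_of_id t n M :
  (forall P, xi_proj xi P -> coresdim_le xi (xi_inj xi) t P) ->
  resdim_le xi (xi_proj xi) n M -> resdim_le xi (xi_proj xi) t M.
Proof.
move=> idP; elim: n => [|n IH] h; first by apply: pd_le_leq h.
have [nt|tn] := ltnP n t; first by apply: pd_le_leq h.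
by apply: IH; apply: (pd_le_descend idP (j := 0)) h; rewrite ?addn0.
Qed.

End DimensionsDual.

(** * Gorenstein projectives *)

Section CompleteComplexes.
Variables (cC : extriangulated) (xi : etri_class cC).
Implicit Types (A B C K P W : cC) (S : set cC).
Implicit Type ex : forall A B C, hom A B -> hom B C -> Prop.

Definition link S ex K' K : Prop :=
  exists P (g : hom K' P) (f : hom P K) (d : ext cC K K'),
    [/\ in_xi xi g f d, S P & ex _ _ _ g f].

Lemma complete_complex_of_links S ex (z : int -> cC) :
  (forall n, link S ex (z (n + 1)) (z n)) ->
  exists R : complete_complex xi S ex, cc_syz R = z.
Proof.
move=> lk.
have L n : {P : cC & {g : hom (z (n + 1)) P & {f : hom P (z n) &
    {d : ext cC (z n) (z (n + 1)) | [/\ in_xi xi g f d, S P & ex _ _ _ g f]}}}}.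
  by have /cid[P /cid[g /cid[f /cid[d h]]]] := lk n; exists P, g, f, d.
pose P n := projT1 (L n); pose g n : hom (z (n + 1)) (P n) := projT1 (projT2 (L n)).
pose f n : hom (P n) (z n) := projT1 (projT2 (projT2 (L n))).
pose d n := sval (projT2 (projT2 (projT2 (L n)))).
have h n : [/\ in_xi xi (g n) (f n) (d n), S (P n) & ex _ _ _ (g n) (f n)].
  exact: svalP (projT2 (projT2 (projT2 (L n)))).
have dd n : (g n \oc f (n + 1)) \oc (g (n + 1) \oc f (n + 1 + 1)) = 0.
  have [t _ _] := h (n + 1).
  by rewrite -compA (compA (f _)) (etri_comp0 (xi_etri t)) comp0m compm0.
have h1 n : S (P n) by case: (h n).
have h2 n : in_xi xi (g n) (f n) (d n) by case: (h n).
have h3 n : ex _ _ _ (g n) (f n) by case: (h n).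
by exists (@CompleteComplex cC xi S ex P z _ g f d dd h1 h2 h3 (fun=> erefl)).
Qed.

(** Starting from A, iterate a choice of links inside [T] in both directions. *)
Lemma complete_complex_of_class S ex (T : set cC) :
  (forall W, T W -> exists K, T K /\ link S ex K W) ->
  (forall W, T W -> exists K, T K /\ link S ex W K) ->
  forall A, T A -> exists (R : complete_complex xi S ex) (n : int), cc_syz R n = A.
Proof.
move=> left right A TA.
(* For W outside [T] the witness is W itself, which makes the choice function total. *)
have /choice[l hl] W : exists K, T W -> T K /\ link S ex K W.
  by have [/left[K]|?] := pselect (T W); [exists K | exists W].
have /choice[r hr] W : exists K, T W -> T K /\ link S ex W K.
  by have [/right[K]|?] := pselect (T W); [exists K | exists W].
have Tl n : T (iter n l A) by elim: n => //= n /hl[].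
have Tr n : T (iter n r A) by elim: n => //= n /hr[].
(* Syzygies have nonnegative indices; [Negz n] is - (n + 1), hence the extra iteration of [r]. *)
pose z (n : int) := match n with Posz n => iter n l A | Negz n => iter n.+1 r A end.
have [|R ez] := @complete_complex_of_links S ex z; last first.
  by exists R, 0; rewrite ez.
case=> [n|[|n]].
- have -> : Posz n + 1 = Posz n.+1 by rewrite -PoszD addn1.
  by have [] := hl _ (Tl n).
- by have [] := hr _ TA.
- have -> : Negz n.+1 + 1 = Negz n by rewrite !NegzE -addn1 PoszD opprD addrNK.
  by have [] := hr _ (Tr n.+1).
Qed.

Lemma cc_syz_link S ex (R : complete_complex xi S ex) n :
  link S ex (cc_syz R (n + 1)) (cc_syz R n).
Proof.
exists (cc_term R n), (cc_g R n), (cc_f R n), (cc_ext R n).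
by split; [apply: cc_xi | apply: cc_termW | apply: cc_exact].
Qed.

Lemma cc_syz_link_pred S ex (R : complete_complex xi S ex) n :
  link S ex (cc_syz R n) (cc_syz R (n - 1)).
Proof. by have := cc_syz_link R (n - 1); rewrite subrK. Qed.

End CompleteComplexes.

Section GorensteinDual.
Variables (cC : extriangulated) (xi : etri_class cC).
Local Notation opC := (op_extriangulated cC).
Local Notation opxi := (op_class xi).

Lemma op_link_proj (K K' : cC) :
  @link opC opxi (xi_proj opxi) (to_class_exact (xi_proj opxi)) K' K <->
  link xi (xi_inj xi) (from_class_exact (xi_inj xi)) K K'.
Proof.
rewrite op_xi_proj.
by split=> -[P [g [f [d [h Pp e]]]]]; exists P, f, g, d.
Qed.

(** Reversing arrows reverses the indexing, so the complex is rebuilt from its links at - k. *)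
Lemma op_xi_Gproj : xi_Gproj opxi = xi_Ginj xi.
Proof.
apply/seteqP; split=> A [R [n <-]].
  have [k|R' eR'] := @complete_complex_of_links _ xi (xi_inj xi)
      (from_class_exact (xi_inj xi)) (fun k => cc_syz R (- k)).
    by apply/op_link_proj; have := cc_syz_link_pred R (- k); rewrite opprD.
  by exists R', (- n); rewrite eR' opprK.
have [k|R' eR'] := @complete_complex_of_links _ opxi (xi_proj opxi)
    (to_class_exact (xi_proj opxi)) (fun k => cc_syz R (- k)).
  by apply/op_link_proj; have := cc_syz_link_pred R (- k); rewrite opprD.
by exists R', (- n); rewrite eR' opprK.
Qed.

End GorensteinDual.

(** * Bounds on dimensions from Gorenstein projective resolutions *)

Section GorensteinProjective.
Variables (cC : extriangulated) (xi : etri_class cC).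
Implicit Types (A B C G H I K L M N P W X Z : cC) (S T : set cC).
Hypotheses (xiP : proper xi) (eP : enough_proj xi) (eI : enough_inj xi).

Lemma Gproj_cosyz G : xi_Gproj xi G ->
  exists P G', [/\ xitri xi G P G', xi_proj xi P & xi_Gproj xi G'].
Proof.
move=> [R [n <-]]; have [P [g [f [d [h Pp _]]]]] := cc_syz_link_pred R n.
exists P, (cc_syz R (n - 1)); split=> //; first by exists g, f, d.
by exists R, (n - 1).
Qed.

Lemma Gproj_syz G : xi_Gproj xi G ->
  exists K P, [/\ xitri xi K P G, xi_proj xi P & xi_Gproj xi K].
Proof.
move=> [R [n <-]]; have [P [g [f [d [h Pp _]]]]] := cc_syz_link R n.
exists (cc_syz R (n + 1)), P; split=> //; first by exists g, f, d.
by exists R, (n + 1).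
Qed.

Lemma Gproj_van G P : xi_Gproj xi G -> xi_proj xi P -> xivan xi G P.
Proof.
move=> [R [n <-]] Pp.
have [Q [g [f [d [h Qp /(_ _ Pp)[_ _ sur]]]]]] := cc_syz_link R n.
apply: (xivan_of_extend xiP h); last exact: sur.
exact: (xi_proj_van xiP eP Qp).
Qed.

(* The right half of a complete projective resolution. Unlike
   [xi_Gproj], it is visibly closed under extensions: no left exactness of
   C(-, P) has to be checked. *)
Definition coresolvable : set cC := [set A | exists T : set cC, T A /\
  forall W, T W -> (forall P, xi_proj xi P -> xivan xi W P) /\
    exists P W', [/\ xitri xi W P W', xi_proj xi P & T W']].

Lemma coresolvable_van A P : coresolvable A -> xi_proj xi P -> xivan xi A P.
Proof. by move=> [T [TA h]] Pp; have [van _] := h _ TA; apply: van. Qed.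

Lemma coresolvable_cosyz A : coresolvable A ->
  exists P A', [/\ xitri xi A P A', xi_proj xi P & coresolvable A'].
Proof.
move=> [T [TA h]]; have [_ [P [A' [t Pp TA']]]] := h _ TA.
by exists P, A'; split=> //; exists T.
Qed.

Lemma Gproj_coresolvable : xi_Gproj xi `<=` coresolvable.
Proof.
move=> A GA; exists (xi_Gproj xi); split=> // W GW.
by split; [move=> P; apply: Gproj_van | apply: Gproj_cosyz].
Qed.

(** The extensions of coresolvable objects form a witnessing class: [xivan_ext] gives the vanishing
    and the horseshoe gives the cosyzygies. *)
Lemma coresolvable_ext G1 X G2 :
  xitri xi G1 X G2 -> coresolvable G1 -> coresolvable G2 -> coresolvable X.
Proof.
move=> t c1 c2; exists [set Y | exists A B,
  [/\ xitri xi A Y B, coresolvable A & coresolvable B]].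
split=> [|W [A [B [{}t cA cB]]]]; first by exists G1, G2.
split=> [P Pp|].
  by apply: (xivan_ext xiP eI t); apply: coresolvable_van.
have [P [A' [tA Pp cA']]] := coresolvable_cosyz cA.
have [P' [B' [tB Pp' cB']]] := coresolvable_cosyz cB.
have van : xivan xi B P by apply: coresolvable_van.
have [S [Y [t1 t2]]] := horseshoe_infl xiP tA t tB van.
exists S, Y; split=> //; first exact: (xi_proj_biproduct xiP eP).
by exists A', B'.
Qed.

(** Induct along the Gorenstein resolution, replacing its middle term by a projective at the price
    of a coresolvable cokernel. *)
Lemma Gpd_approximation n M : resdim_le xi (xi_Gproj xi) n M ->
  exists H G, [/\ xitri xi M H G, resdim_le xi (xi_proj xi) n H & coresolvable G].
Proof.
elim: n M => [|n IH] M.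
  move=> /Gproj_cosyz[P [G [t Pp GG]]]; exists P, G; split=> //.
  exact: Gproj_coresolvable.
move=> /resdim_leS[K [G [t GG /IH[H [G' [tH pdH cG']]]]]].
have [P [G1 [tP Pp GG1]]] := Gproj_cosyz GG.
(* This replaces K -> G -> M by K -> P -> Z, with M inside Z and cokernel G1. *)
have [Z [tZ tM]] := xitri_comp xiP t tP.
have [P' [G2 [tG' Pp' cG2]]] := coresolvable_cosyz cG'.
have van : xivan xi G' P by apply: coresolvable_van.
(* The horseshoe gives H -> P (+) P' -> Y with Z inside Y and cokernel G2; then M lies inside Y with
   cokernel an extension of G2 by G1. *)
have [S [Y [tY tZY]]] := horseshoe_infl xiP tZ tH tG' van.
have [X [tX tX']] := xitri_comp xiP tM tZY.
exists Y, X; split=> //; last first.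
  by apply: coresolvable_ext tX' _ cG2; apply: Gproj_coresolvable.
apply/resdim_leS; exists H, S; split=> //.
exact: (xi_proj_biproduct xiP eP).
Qed.

(** For n = 0, shift k times along the complete resolution and the coresolution of a projective,
    down to [Gproj_van]. In general shift along M, the Gorenstein middle terms being covered by the
    case n = 0. *)
Lemma Gpd_le_van n M : resdim_le xi (xi_Gproj xi) n M ->
  forall k L, (n <= k)%N -> cosyz xi (xi_proj xi) k L -> xivan xi M L.
Proof.
have base k : forall G L, xi_Gproj xi G -> cosyz xi (xi_proj xi) k L -> xivan xi G L.
  elim: k => [|k IH] G L GG /=; first exact: Gproj_van.
  move=> [L' [I [t Ii hL']]]; have [K [P [tK Pp GK]]] := Gproj_syz GG.
  apply: (xivan_shift xiP tK t Ii); first exact: IH.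
  exact: xi_proj_van.
elim: n M => [|n IH] M; first by move=> GM k L _; apply: base.
move=> /resdim_leS[K [G [t GG hK]]] [//|k] L nk hL.
have [L' [I [tL Ii hL']]] := hL.
by apply: (xivan_shift xiP t tL Ii); [apply: (IH K hK k) | apply: base hL].
Qed.

Lemma dims_le_of_Gpd m :
  (forall M, exists2 n, (n <= m)%N & resdim_le xi (xi_Gproj xi) n M) ->
  (forall I, xi_inj xi I -> resdim_le xi (xi_proj xi) m I) /\
  (forall P, xi_proj xi P -> coresdim_le xi (xi_inj xi) m P).
Proof.
move=> gpd; split=> [I Ii|P Pp].
  have [n nm /Gpd_approximation[H [G [t pdH _]]]] := gpd I.
  exact: pd_le_leq nm (pd_le_inj xiP eP eI t Ii pdH).
apply: (xi_inj_coresdim_le eI) => L hL; apply/(xi_injP xiP eI) => M.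
have [n nm hn] := gpd M; apply: Gpd_le_van hn _ _ nm _.
apply/op_syz; have /op_syz := hL; apply: syz_subset.
by move=> _ ->.
Qed.

End GorensteinProjective.

(** * Syzygies as Gorenstein projective objects *)

Section GorensteinBound.
Variables (cC : extriangulated) (xi : etri_class cC).
Implicit Types (A B C G H I K L M N P Q W X Z : cC) (S T : set cC).
Hypotheses (xiP : proper xi) (eP : enough_proj xi) (eI : enough_inj xi).

Lemma syz_base S n W : syz xi S n W -> exists M, S M /\ syz xi [set M] n W.
Proof.
elim: n W => [|n IH] W; first by exists W.
move=> [W' [P [t Pp /IH[M [SM h]]]]].
by exists M; split=> //; exists W', P.
Qed.

(** The horseshoe over M -> H -> M' gives a triangle K -> X -> K' of first syzygies in which X is a
    syzygy of H. After n steps the middle term is projective. *)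
Lemma syz_cosyzygy n M H M' W :
  xitri xi M H M' -> resdim_le xi (xi_proj xi) n H -> syz xi [set M] n W ->
  exists Q W', [/\ xitri xi W Q W', xi_proj xi Q & syz xi [set M'] n W'].
Proof.
elim: n M H M' W => [|n IH] M H M' W t pdH.
  by move=> ->; exists H, M'.
move=> /syzSr[_ [K [P [-> tK Pp hW]]]].
have [K' [P' [x [y [d [xyd Pp']]]]]] := eP M'.
have tK' : xitri xi K' P' M' by exists x, y, d.
have van : xivan xi P' M by apply: xi_proj_van.
have [S [X [tX tKX]]] := horseshoe_defl xiP tK' t tK van.
have Sp : xi_proj xi S by apply: (xi_proj_biproduct xiP eP).
have [Q [W' [tW Qp hW']]] := IH _ _ _ _ tKX (pd_le_syz xiP eP eI tX Sp pdH) hW.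
by exists Q, W'; split=> //; apply/syzSr; exists M', K', P'.
Qed.

(** Resolve the zero object by zeros and end with P = P -> 0. *)
Lemma syz_proj n P : xi_proj xi P -> syz xi setT n P.
Proof.
move=> Pp; have [Z Z0] := zero_ex cC.
have tZ A : xitri xi A A Z.
  by do 3!eexists; apply: (proper_split xiP); apply: etri_zero_r Z0 A.
have Zp : xi_proj xi Z.
  apply/(xi_projP xiP eP) => N B x y d _.
  by rewrite -[d]pull1 (Z0.1 _ (idm Z)) pull0r.
have hZ k : syz xi setT k Z by elim: k => [//|k IH]; exists Z, Z.
by case: n => [//|n]; exists Z, P.
Qed.

Variable m : nat.
Hypothesis pdI : forall I, xi_inj xi I -> resdim_le xi (xi_proj xi) m I.
Hypothesis idP : forall P, xi_proj xi P -> coresdim_le xi (xi_inj xi) m P.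
(** This is the part of exactness supplied by Condition (star). Both halves of that condition use
    projective resolutions, so it does not pass to the opposite category by conversion; isolating
    its consequence keeps this section dualizable. *)
Hypothesis lexP : forall K Q W (x : hom K Q) (y : hom Q W) (d : ext cC W K),
  in_xi xi x y d -> xi_proj xi Q -> syz xi setT m W ->
  forall P (h : hom W P), xi_proj xi P -> h \oc y = 0 -> h = 0.

Lemma syz_to_proj_exact K Q W (x : hom K Q) (y : hom Q W) (d : ext cC W K) :
  in_xi xi x y d -> xi_proj xi Q -> syz xi setT m W ->
  to_class_exact (xi_proj xi) x y.
Proof.
move=> xyd Qp hW P Pp; split.
- move=> u v /eqP; rewrite -subr_eq0 -compBl => /eqP e.
  by apply/eqP; rewrite -subr_eq0; apply/eqP/(lexP xyd).
- move=> f; split=> [/(factor_defl (xi_etri xyd))//|[u <-]].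
  by rewrite /precomp -compA (etri_comp0 (xi_etri xyd)) compm0.
(* The obstruction to extending a lies in E_xi(W, P), which is 0 because W is an m-th syzygy and P
   has injective dimension at most m. *)
- move=> a; apply: (extend_infl (xi_etri xyd)); apply: (xivan_push xiP a xyd).
  by move/(id_leP xiP eP eI): (idP Pp); apply.
Qed.

Lemma Gpd_le_of_dims M : resdim_le xi (xi_Gproj xi) m M.
Proof.
have sG : syz xi setT m `<=` xi_Gproj xi.
  apply: complete_complex_of_class => W hW.
    have [K [P [x [y [d [xyd Pp]]]]]] := eP W; exists K; split; last first.
      by exists P, x, y, d; split=> //; apply: syz_to_proj_exact xyd Pp hW.
    (* A syzygy of an m-th syzygy is an (m + 1)-th syzygy, hence the m-th syzygy of a first
       syzygy. *)
    apply: (@syz_setTW _ _ m 1); rewrite addn1.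
    by exists W, P; split=> //; exists x, y, d.
  have [N [_ hN]] := syz_base hW.
  have [I [N' [x [y [d [xyd Ii]]]]]] := eI N.
  have t : xitri xi N I N' by exists x, y, d.
  have [Q [W' [[x' [y' [d' t']]] Qp hW']]] := syz_cosyzygy t (pdI Ii) hN.
  have {}hW' : syz xi setT m W' by apply: syz_subset hW'.
  exists W'; split=> //; exists Q, x', y', d'.
  by split=> //; apply: syz_to_proj_exact t' _ _.
apply: (resdim_le_of_syz eP) => [P Pp|W hW]; apply: sG.
  exact: syz_proj.
by apply: syz_subset hW.
Qed.

End GorensteinBound.

(** * Derived functors and Condition (star) *)

Section Homology.
Variables (U V W : zmodType) (f : {additive U -> V}) (g : {additive V -> W}).

Lemma homology_eq0 : (forall v, g v = 0 -> exists u, f u = v) ->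
  forall h : homology f g, h = 0.
Proof.
move=> ex h; have pi0 : \pi_(homology f g)%qT 0 = 0 by exact: raddf0.
rewrite -[h]reprK -pi0; apply/eqP; rewrite -Quotient.idealrBE subr0.
rewrite unfold_in; apply/asboolP; apply: ex; apply/eqP.
exact: (valP (repr h)).
Qed.

End Homology.

Section Resolutions.
Variables (cC : extriangulated) (xi : etri_class cC).
Implicit Types (A B C I K M N P Q W X : cC).

Lemma proj_resolution_ex A : enough_proj xi -> inhabited (proj_resolution xi A).
Proof.
move=> eP.
have /choice[ker hker] B : exists K, exists P (x : hom K P) (y : hom P B)
  (d : ext cC B K), in_xi xi x y d /\ xi_proj xi P by exact: eP.
(* Inlining the body of [syzygy] makes [syzygy A next n.+1] convertible to [ker (syzygy A next n)]
   once n is a constructor. *)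
pose next := fix next n := ker (if n is n'.+1 then next n' else A).
have L n : {P : cC & {g : hom (syzygy A next n.+1) P & {f : hom P (syzygy A next n) &
    {d : ext cC (syzygy A next n) (syzygy A next n.+1) |
    in_xi xi g f d /\ xi_proj xi P}}}}.
  have /cid[P /cid[g /cid[f /cid[d h]]]] : exists P
      (g : hom (syzygy A next n.+1) P) (f : hom P (syzygy A next n))
      (d : ext cC (syzygy A next n) (syzygy A next n.+1)),
      in_xi xi g f d /\ xi_proj xi P.
    by case: n => [|n]; apply: hker.
  by exists P, g, f, d.
pose P n := projT1 (L n).
pose g n : hom (syzygy A next n.+1) (P n) := projT1 (projT2 (L n)).
pose f n : hom (P n) (syzygy A next n) := projT1 (projT2 (projT2 (L n))).
pose d n := sval (projT2 (projT2 (projT2 (L n)))).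
have h n : in_xi xi (g n) (f n) (d n) /\ xi_proj xi (P n).
  exact: svalP (projT2 (projT2 (projT2 (L n)))).
constructor.
exact: (@ProjResolution cC xi A P next g f d (fun n => (h n).2) (fun n => (h n).1)).
Qed.

Section Cons.
Variables (A K P : cC) (x : hom K P) (y : hom P A) (d : ext cC A K).
Hypotheses (xyd : in_xi xi x y d) (Pp : xi_proj xi P).
Variable R : proj_resolution xi K.

Let term n := if n is n'.+1 then pr_term R n' else P.
Let next n := if n is n'.+1 then pr_next R n' else K.

(** Prepending a conflation shifts degrees by conversion, so [xixt_van_cons] needs no transport. *)
Definition pr_cons : proj_resolution xi A :=
  @ProjResolution cC xi A term next
    (fun n => match n return hom (syzygy A next n.+1) (term n) with
              | 0%N => x | n'.+1 => pr_g R n' end)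
    (fun n => match n return hom (term n) (syzygy A next n) with
              | 0%N => y | n'.+1 => pr_f R n' end)
    (fun n => match n return ext cC (syzygy A next n) (syzygy A next n.+1) with
              | 0%N => d | n'.+1 => pr_ext R n' end)
    (fun n => match n return xi_proj xi (term n) with
              | 0%N => Pp | n'.+1 => pr_proj R n' end)
    (fun n => match n with 0%N => xyd | n'.+1 => pr_xi R n' end).
End Cons.

(** An elementary form of the vanishing of xixt in degree j + 1, not j. *)
Definition xixt_van M (R : proj_resolution xi M) N (j : nat) : Prop :=
  forall f : hom (pr_term R j.+1) N, f \oc pr_d R j.+1 = 0 ->
  exists h : hom (pr_term R j) N, h \oc pr_d R j = f.

Lemma xixt_van_cons A K P (x : hom K P) (y : hom P A) (d : ext cC A K)
    (xyd : in_xi xi x y d) (Pp : xi_proj xi P) (R : proj_resolution xi K) N j :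
  xixt_van (pr_cons xyd Pp R) N j.+1 <-> xixt_van R N j.
Proof. by []. Qed.

Lemma xixt_eq0 M (R : proj_resolution xi M) N :
  (forall j, xixt_van R N j) ->
  forall i, (1 <= i)%N -> forall u : xixt N R i, u = 0.
Proof. by move=> van [//|j] _; apply: homology_eq0; apply: van. Qed.

Lemma xixt0_map_inj0 M (R : proj_resolution xi M) N (h : hom M N) :
  bijective (@xixt0_map cC xi M N R) -> h \oc pr_aug R = 0 -> h = 0.
Proof.
move=> /bij_inj inj e; apply: inj; rewrite /xixt0_map; congr (\pi _)%qT.
by apply: val_inj; rewrite /= e comp0m.
Qed.

End Resolutions.

(** * Dimension shifting for derived functors *)

Section DerivedVanishing.
Variables (cC : extriangulated) (xi : etri_class cC).
Implicit Types (A B C I K M N P Q W X : cC).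
Hypotheses (xiP : proper xi) (eP : enough_proj xi) (eI : enough_inj xi).

Section Shift.
Variables (M : cC) (R : proj_resolution xi M).

Lemma postcomp_inj_proj X I X' (i : hom X I) (q : hom I X') (l : ext cC X' X)
    P (f : hom P X) :
  in_xi xi i q l -> xi_proj xi P -> i \oc f = 0 -> f = 0.
Proof.
move=> t Pp e; have [inj _ _] := Pp _ _ _ _ _ _ t.
by apply: inj; rewrite /postcomp e compm0.
Qed.

Lemma postcomp_surj_proj X I X' (i : hom X I) (q : hom I X') (l : ext cC X' X)
    P (f : hom P X') :
  in_xi xi i q l -> xi_proj xi P -> exists g, q \oc g = f.
Proof. by move=> t Pp; have [_ _ /(_ f)] := Pp _ _ _ _ _ _ t. Qed.

Lemma pr_d0 n : pr_d R n \oc pr_d R n.+1 = 0.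
Proof.
rewrite /pr_d -compA (compA (pr_f R n.+1)).
by rewrite (etri_comp0 (xi_etri (pr_xi R n.+1))) comp0m compm0.
Qed.

Lemma xixt_van_inj I j : xi_inj xi I -> xixt_van R I j.
Proof.
move=> Ii f e.
have fg : f \oc pr_g R j.+1 = 0.
  have [inj _ _] := Ii _ _ _ _ _ _ (pr_xi R j.+2).
  by apply: inj; rewrite /precomp -compA e comp0m.
have [h eh] := factor_defl (xi_etri (pr_xi R j.+1)) fg.
have [_ _ /(_ h)[h' eh']] := Ii _ _ _ _ _ _ (pr_xi R j).
by exists h'; rewrite /pr_d compA -[h' \oc _]/(precomp _ h') eh' eh.
Qed.

Section Step.
Variables (X I X' : cC).
Hypotheses (t : xitri xi X I X') (Ii : xi_inj xi I).

(** The terms of R are projective, so C(P_j, -) is exact on X -> I -> X'. Since I is acyclic,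
    chasing the connecting map gives this lemma and [xixt_van_down]. *)
Lemma xixt_van_up j : xixt_van R X' j -> xixt_van R X j.+1.
Proof.
have [i [q [l tl]]] := t; move=> van f e.
have [u eu] : exists u, u \oc pr_d R j.+1 = i \oc f.
  by apply: (xixt_van_inj Ii); rewrite -compA e compm0.
have [v ev] : exists v, v \oc pr_d R j = q \oc u.
  by apply: van; rewrite -compA eu compA (etri_comp0 (xi_etri tl)) comp0m.
have [w ew] := postcomp_surj_proj v tl (pr_proj R j).
have [z ez] : exists z, i \oc z = u - w \oc pr_d R j.
  by apply: (factor_infl (xi_etri tl)); rewrite compBr compA ew ev subrr.
exists z; apply/eqP; rewrite -subr_eq0; apply/eqP.
apply: (postcomp_inj_proj tl (pr_proj R _)).
by rewrite compBr compA ez compBl -compA pr_d0 compm0 subr0 eu subrr.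
Qed.

Lemma xixt_van_down j : xixt_van R X j.+1 -> xixt_van R X' j.
Proof.
have [i [q [l tl]]] := t; move=> van f e.
have [w ew] := postcomp_surj_proj f tl (pr_proj R j.+1).
have [z ez] : exists z, i \oc z = w \oc pr_d R j.+1.
  by apply: (factor_infl (xi_etri tl)); rewrite compA ew.
have [z' ez'] : exists z', z' \oc pr_d R j.+1 = z.
  apply: van; apply: (postcomp_inj_proj tl (pr_proj R _)).
  by rewrite compA ez -compA pr_d0 compm0.
have [v ev] : exists v, v \oc pr_d R j = w - i \oc z'.
  by apply: (xixt_van_inj Ii); rewrite compBl -compA ez' ez subrr.
exists (q \oc v); rewrite -compA ev compBr ew compA.
by rewrite (etri_comp0 (xi_etri tl)) comp0m subr0.
Qed.

End Step.

Lemma xixt_van_id n X j :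
  coresdim_le xi (xi_inj xi) n X -> (n <= j)%N -> xixt_van R X j.
Proof.
elim: n X j => [|n IH] X j; first by move=> Xi _; apply: xixt_van_inj.
move=> [I [X' [x [y [d [xyd Ii idX']]]]]]; case: j => [//|j] nj.
by apply: (xixt_van_up _ Ii); [exists x, y, d | apply: IH].
Qed.

Lemma pd_le_syzygy n j : resdim_le xi (xi_proj xi) n M ->
  resdim_le xi (xi_proj xi) (n - j) (syzygy M (pr_next R) j).
Proof.
move=> pdM; elim: j => [|j IH]; first by rewrite subn0.
rewrite subnS; apply: (pd_le_syz xiP eP eI) (pr_proj R j) IH.
by do 3!eexists; apply: (pr_xi R j).
Qed.

Lemma xixt_van_pd n X j :
  resdim_le xi (xi_proj xi) n M -> (n <= j)%N -> xixt_van R X j.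
Proof.
move=> pdM nj f e.
have syzp k : (n <= k)%N -> xi_proj xi (syzygy M (pr_next R) k).
  by move=> nk; have := pd_le_syzygy k pdM; have -> : (n - k = 0)%N by apply/eqP.
(* The syzygies from index n on are projective. The section [s] of the deflation onto the syzygy of
   index j + 2 lets it be cancelled from [e]; projectivity at index j removes the obstruction to
   extending h. *)
have p2 := syzp j.+2 (leqW (leqW nj)).
have [s es] := postcomp_surj_proj (idm _) (pr_xi R j.+2) p2.
have fg : f \oc pr_g R j.+1 = 0.
  by rewrite -[LHS]compm1 -es compA -(compA f) e comp0m.
have [h eh] := factor_defl (xi_etri (pr_xi R j.+1)) fg.
have vj : push h (pr_ext R j) = 0.
  by apply: (xivan_push xiP _ (pr_xi R j)); apply: xi_proj_van => //; apply: syzp.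
have [h' eh'] := extend_infl (xi_etri (pr_xi R j)) vj.
by exists h'; rewrite /pr_d compA eh' eh.
Qed.

(** Each cosyzygy step trades degree j for j + 1, until the degree exceeds the projective dimension
    of M. *)
Lemma xixt_van_cosyz n k X j : resdim_le xi (xi_proj xi) n M ->
  cosyz xi setT k X -> (n <= k + j)%N -> xixt_van R X j.
Proof.
move=> pdM; elim: k X j => [|k IH] X j /=.
  by move=> _; apply: xixt_van_pd.
move=> [X' [I [t Ii hX']]] nkj; apply: (xixt_van_down t Ii).
by apply: (IH X' j.+1 hX'); rewrite addnS -addSn.
Qed.

End Shift.

(** Prepending the conflation W -> P -> W' to R computes the same group for W' one degree higher,
    until the injective dimension of X is exceeded. *)
Lemma xixt_van_syz n k W (R : proj_resolution xi W) X j :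
  coresdim_le xi (xi_inj xi) n X -> syz xi setT k W -> (n <= k + j)%N ->
  xixt_van R X j.
Proof.
move=> idX; elim: k W R j => [|k IH] W R j /=.
  by move=> _; apply: xixt_van_id.
move=> [W' [P [[x [y [d xyd]]] Pp hW']]] nkj.
rewrite addSn -addnS in nkj.
exact: (xixt_van_cons xyd Pp R X j).1 (IH W' _ j.+1 hW' nkj).
Qed.

Lemma least_finite (P : nat -> Prop) n : P n -> least P <> Infty.
Proof.
rewrite /least; case: pselect => // nex Pn.
by case: nex; exists n; apply/asboolP.
Qed.

Hypothesis star : condition_star xi.

Lemma star_lex_proj m : (forall P, xi_proj xi P -> coresdim_le xi (xi_inj xi) m P) ->
  forall K Q W (x : hom K Q) (y : hom Q W) (d : ext cC W K),
  in_xi xi x y d -> xi_proj xi Q -> syz xi setT m W ->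
  forall P (h : hom W P), xi_proj xi P -> h \oc y = 0 -> h = 0.
Proof.
move=> idP K Q W x y d xyd Qp hW P h Pp hy.
(* The resolution of W starts with Q, so its augmentation is y and the natural map sends h to the
   class of h y = 0. *)
have [R] := proj_resolution_ex K eP; pose R' := pr_cons xyd Qp R.
apply: (@xixt0_map_inj0 _ _ _ R' _ _ _ hy).
apply: star.2; first by apply: (@least_finite _ m); apply: idP.
by apply: xixt_eq0 => j; apply: xixt_van_syz (idP _ Pp) hW _; apply: leq_addr.
Qed.

Lemma star_lex_inj m : (forall I, xi_inj xi I -> resdim_le xi (xi_proj xi) m I) ->
  forall W J L (x : hom W J) (y : hom J L) (d : ext cC L W),
  in_xi xi x y d -> cosyz xi setT m W ->
  forall I (h : hom I W), xi_inj xi I -> x \oc h = 0 -> h = 0.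
Proof.
move=> pdI W J L x y d xyd hW I h Ii xh.
have [R] := proj_resolution_ex I eP.
(* The inflation x is only known to be monic against projectives, hence the passage to the
   augmentation. *)
have haug : h \oc pr_aug R = 0.
  by apply: (postcomp_inj_proj xyd (pr_proj R 0)); rewrite compA xh comp0m.
apply: (@xixt0_map_inj0 _ _ _ R _ _ _ haug).
apply: star.1; first by apply: (@least_finite _ m); apply: pdI.
by apply: xixt_eq0 => j; apply: xixt_van_cosyz (pdI _ Ii) hW _; apply: leq_addr.
Qed.

End DerivedVanishing.

Section ExtendedNaturals.
Implicit Types (P Q : nat -> Prop).

Lemma least_le P n : enat_le (least P) (Fin n) <-> exists2 k, (k <= n)%N & P k.
Proof.
rewrite /least; case: pselect => [ex|nex]; last first.
  by split=> // -[k _ Pk]; case: nex; exists k; apply/asboolP.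
case: ex_minnP => k /asboolP Pk kmin; split=> [kn|[j jn Pj]]; first by exists k.
by apply: leq_trans jn; apply: kmin; apply/asboolP.
Qed.

Lemma esup_le (S : set enat) n :
  enat_le (esup S) (Fin n) <-> forall d, S d -> enat_le d (Fin n).
Proof.
rewrite least_le; split=> [[k kn h] d /h|h]; last by exists n.
by case: d => //= j jk; apply: leq_trans kn.
Qed.

End ExtendedNaturals.

(** * Global dimensions *)

Section GlobalDimensions.
Variables (cC : extriangulated) (xi : etri_class cC).
Hypotheses (xiP : proper xi) (eP : enough_proj xi) (eI : enough_inj xi).

Lemma id_le_leq n k N : (n <= k)%N ->
  coresdim_le xi (xi_inj xi) n N -> coresdim_le xi (xi_inj xi) k N.
Proof.
move=> /subnKC <- /(id_leP xiP eP eI) h; apply/(id_leP xiP eP eI) => W hW.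
by apply: h; apply: syz_setTW hW.
Qed.

Lemma spli_le n : enat_le (spli xi) (Fin n) <->
  (forall I, xi_inj xi I -> resdim_le xi (xi_proj xi) n I).
Proof.
rewrite esup_le; split=> [h I Ii|h _ [I Ii <-]]; last first.
  by apply/least_le; exists n => //; apply: h.
have /least_le[k kn] : enat_le (xi_pd xi I) (Fin n) by apply: h; exists I.
exact: pd_le_leq.
Qed.

Lemma silp_le n : enat_le (silp xi) (Fin n) <->
  (forall P, xi_proj xi P -> coresdim_le xi (xi_inj xi) n P).
Proof.
rewrite esup_le; split=> [h P Pp|h _ [P Pp <-]]; last first.
  by apply/least_le; exists n => //; apply: h.
have /least_le[k kn] : enat_le (xi_id xi P) (Fin n) by apply: h; exists P.
exact: id_le_leq.
Qed.

Lemma esup_resdim_le (S : set cC) n :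
  enat_le (esup [set resdim xi S M | M in [set: cC]]) (Fin n) <->
  (forall M, exists2 k, (k <= n)%N & resdim_le xi S k M).
Proof.
rewrite esup_le; split=> [h M|h _ [M _ <-]]; last exact/least_le.
by apply/least_le; apply: h; exists M.
Qed.

Lemma esup_coresdim_le (S : set cC) n :
  enat_le (esup [set coresdim xi S M | M in [set: cC]]) (Fin n) <->
  (forall M, exists2 k, (k <= n)%N & coresdim_le xi S k M).
Proof.
rewrite esup_le; split=> [h M|h _ [M _ <-]]; last exact/least_le.
by apply/least_le; apply: h; exists M.
Qed.

Lemma id_le_of_pd t n N :
  (forall I, xi_inj xi I -> resdim_le xi (xi_proj xi) t I) ->
  coresdim_le xi (xi_inj xi) n N -> coresdim_le xi (xi_inj xi) t N.
Proof.
move=> pdI /op_resdim_le; rewrite -op_xi_proj => h.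
have := pd_le_of_id (op_class_proper xiP) (op_enough_proj eI) (op_enough_inj eP) _ h.
rewrite op_xi_proj op_xi_inj => h'.
by apply/op_resdim_le/h' => I /pdI/op_coresdim_le.
Qed.

Lemma enat_le_antisym d e : enat_le d e -> enat_le e d -> d = e.
Proof.
by case: d e => [m|] [n|] //= mn nm; congr Fin; apply/eqP; rewrite eqn_leq mn.
Qed.

Lemma spli_eq_silp m :
  (forall I, xi_inj xi I -> resdim_le xi (xi_proj xi) m I) ->
  (forall P, xi_proj xi P -> coresdim_le xi (xi_inj xi) m P) ->
  spli xi = silp xi /\ enat_le (silp xi) (Fin m).
Proof.
move=> pdI idP; have silpm := (silp_le m).2 idP; split=> //.
have splim := (spli_le m).2 pdI; apply: enat_le_antisym.
  (* The bound m makes the supremum a finite t, and [pd_le_of_id] sharpens the bound m for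
     injectives to t. *)
  case es : (silp xi) silpm => [t|] //= _; apply/spli_le => I /pdI.
  by apply: pd_le_of_id => //; apply/silp_le; rewrite es /=.
case es : (spli xi) splim => [t|] //= _; apply/silp_le => P /idP.
by apply: id_le_of_pd; apply/spli_le; rewrite es /=.
Qed.

Lemma dims_le_of_Gid m :
  (forall M, exists2 n, (n <= m)%N & coresdim_le xi (xi_Ginj xi) n M) ->
  (forall I, xi_inj xi I -> resdim_le xi (xi_proj xi) m I) /\
  (forall P, xi_proj xi P -> coresdim_le xi (xi_inj xi) m P).
Proof.
rewrite -op_xi_Gproj => gid.
have [|pd id] := @dims_le_of_Gpd _ _ (op_class_proper xiP) (op_enough_proj eI)
    (op_enough_inj eP) m.
  by move=> M; have [n nm /op_resdim_le] := gid M; exists n.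
rewrite op_xi_proj op_xi_inj in pd id.
by split=> [I /id /op_coresdim_le|P /pd /op_resdim_le].
Qed.

Lemma Gid_le_of_dims m : condition_star xi ->
  (forall I, xi_inj xi I -> resdim_le xi (xi_proj xi) m I) ->
  (forall P, xi_proj xi P -> coresdim_le xi (xi_inj xi) m P) ->
  forall M, coresdim_le xi (xi_Ginj xi) m M.
Proof.
move=> star pdI idP M; rewrite -op_xi_Gproj; apply/op_resdim_le.
apply: (Gpd_le_of_dims (op_class_proper xiP) (op_enough_proj eI) (op_enough_inj eP)).
- by move=> I; rewrite op_xi_proj op_xi_inj => /idP /op_resdim_le.
- by move=> P; rewrite op_xi_proj op_xi_inj => /pdI /op_coresdim_le.
(* Left exactness in the opposite category is the injective statement obtained from the first half
   of Condition (star). *)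
- rewrite op_xi_proj => K Q W x y d xyd _ /op_syz hW P h Pi.
  exact: (star_lex_inj xiP eP eI star pdI xyd hW).
Qed.

End GlobalDimensions.

Theorem theorem4p7 (cC : extriangulated) (xi : etri_class cC)
  (hWIC : WIC cC) (hxi : proper_class xi)
  (hP : enough_proj xi) (hI : enough_inj xi)
  (hgen : generating (xi_proj xi)) (hcogen : cogenerating (xi_inj xi))
  (m : nat) :
  let cond1 := enat_le (esup [set xi_Gpd xi M | M in [set: cC]]) (Fin m) in
  let cond2 := enat_le (esup [set xi_Gid xi M | M in [set: cC]]) (Fin m) in
  let cond3 := spli xi = silp xi /\ enat_le (silp xi) (Fin m) in
  [/\ cond1 -> cond3, cond2 -> cond3
    & condition_star xi -> (cond3 -> cond1) /\ (cond3 -> cond2)].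
Proof.
have xiP := proper_class_proper hxi; split.
- by move=> /esup_resdim_le/(dims_le_of_Gpd xiP hP hI)[]; apply: spli_eq_silp.
- by move=> /esup_coresdim_le/(dims_le_of_Gid xiP hP hI)[]; apply: spli_eq_silp.
- move=> star; split=> -[eq silpm].
    have := silpm; rewrite -eq => /(spli_le xiP hP hI) pdI.
    have /(silp_le xiP hP hI) idP := silpm.
    apply/esup_resdim_le => M; exists m => //.
    apply: (Gpd_le_of_dims xiP hP hI pdI idP).
    exact: (star_lex_proj hP star idP).
  have := silpm; rewrite -eq => /(spli_le xiP hP hI) pdI.
  have /(silp_le xiP hP hI) idP := silpm.
  apply/esup_coresdim_le => M; exists m => //.
  exact: Gid_le_of_dims.
Qed.
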